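(* Let $h\in\Omega_{\rho_\varepsilon}$ and let $v\in H^1(0,1)$ satisfy $\langle v,u^h_i\rangle=0$ for all $i=1,\dots,N+1$. Then $$\langle\mathcal L^hv,v\rangle\le\Big(-\tfrac12\lambda_0+\mathcal O(\rho_\varepsilon^2)\Big)\|v\|^2 .$$
   Context: $0<\varepsilon\ll1$; $f(u)=u^3-u$; $\langle\cdot,\cdot\rangle$, $\|\cdot\|$ are inner product and norm of $L^2(0,1)$. $U(x)=\tanh(x/\sqrt2)$; $U(x;\xi,\pm1)=\pm U((x-\xi)/\varepsilon)$. Fix an integer $N\ge0$, small $\kappa_0>0$, $\rho_\varepsilon=\varepsilon^{\kappa_0}$. $\Omega_{\rho_\varepsilon}=\{h\in\mathbb R^{N+1}:0<h_1<\dots<h_{N+1}<1,\ \min_{j=0,\dots,N+1}|h_{j+1}-h_j|>\varepsilon/\rho_\varepsilon\}$ with $h_0=-h_1$, $h_{N+2}=2-h_{N+1}$. For $h\in\Omega_{\rho_\varepsilon}$, $u^h=\sum_{j=1}^{N+1}U(\cdot;h_j,(-1)^{j+1})+\beta_N$ where $\beta_N=\frac{(-1)^N-1}{2}+\mathcal O(\exp)$ (also for derivatives) is a correction making $u^h(0)=-1$ and $u^h$ satisfy Neumann boundary conditions; $\mathcal O(\exp)$ means exponentially small in $\varepsilon$. $u^h_i=\partial_{h_i}u^h$. The linearization is $\mathcal L^hv=\varepsilon^2v_{xx}-f'(u^h)v$, so $\langle\mathcal L^hv,v\rangle=-\varepsilon^2\|v_x\|^2-\int_0^1f'(u^h)v^2$.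 $\lambda_0>0$ is a constant such that every $w\in H^1(\mathbb R)$ with $w(0)=0$ or $\int_{\mathbb R}wU'=0$ satisfies $\int_{\mathbb R}(-w'^2-f'(U)w^2)\le-\lambda_0\|w\|^2_{L^2(\mathbb R)}$. The $\mathcal O(\rho_\varepsilon^2)$ constant is independent of $\varepsilon,h,v$. *)

(* Defs.v *)
From HB Require Import structures.
From mathcomp Require Import all_boot all_order all_algebra.
From mathcomp Require Import all_classical all_reals all_analysis.
Set Implicit Arguments. Unset Strict Implicit. Unset Printing Implicit Defensive.
Import Order.TTheory GRing.Theory Num.Theory.
Import numFieldNormedType.Exports.
Local Open Scope classical_set_scope.
Local Open Scope ring_scope.

Definition leb (R : realType) := @lebesgue_measure R.
Arguments leb R : clear implicits.

Definition tanh (R : realType) (y : R) : R :=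
  (expR y - expR (- y)) / (expR y + expR (- y)).

Definition U (R : realType) (x : R) : R := tanh (x / Num.sqrt 2).

Definition f (R : realType) (u : R) : R := u ^+ 3 - u.
Definition fp (R : realType) (u : R) : R := 3 * u ^+ 2 - 1.

Definition L2_on (R : realType) (D : set R) (g : R -> R) : Prop :=
  measurable_fun D g /\
  (\int[leb R]_(x in D) ((g x) ^+ 2)%:E < +oo)%E.

Definition int_from0 (R : realType) (g : R -> R) (x : R) : R :=
  if 0 <= x then Rintegral (leb R) `[0, x] g
  else - Rintegral (leb R) `[x, 0] g.

(* v in H^1(R) with (weak) derivative g: v, g in L^2(R) and
   v is the absolutely continuous representative v(x) = v(0) + int_0^x g *)
Definition H1_line (R : realType) (v g : R -> R) : Prop :=
  L2_on setT v /\ L2_on setT g /\ forall x, v x = v 0 + int_from0 g x.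

(* v in H^1(0,1) with (weak) derivative g: g in L^2(0,1) and
   v(x) = v(0) + int_0^x g on [0,1] (absolutely continuous representative) *)
Definition H1_01 (R : realType) (v g : R -> R) : Prop :=
  L2_on `[0, 1] g /\
  forall x, 0 <= x <= 1 -> v x = v 0 + Rintegral (leb R) `[0, x] g.

Definition lambda0_prop (R : realType) (lambda0 : R) : Prop :=
  forall w g : R -> R, H1_line w g ->
    (w 0 = 0 \/ Rintegral (leb R) setT (fun x => w x * derive1 (@U R) x) = 0) ->
    Rintegral (leb R) setT (fun x => - (g x) ^+ 2 - fp (U x) * (w x) ^+ 2)
      <= - lambda0 * Rintegral (leb R) setT (fun x => (w x) ^+ 2).

(* positions h = (h_1,...,h_{N+1}) are indexed by 'I_(N.+1): h_j = h (j-1) *)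
Definition hupd (R : realType) (N : nat) (h : 'I_N.+1 -> R) (i : 'I_N.+1) (t : R)
  : 'I_N.+1 -> R := fun j => if j == i then t else h j.

(* Omega_{rho}: 0 < h_1 < ... < h_{N+1} < 1 and all gaps |h_{j+1}-h_j|,
   j = 0..N+1 (with h_0 = -h_1, h_{N+2} = 2 - h_{N+1}) exceed eps/rho *)
Definition in_Omega (R : realType) (N : nat) (eps rho : R) (h : 'I_N.+1 -> R) : Prop :=
  [/\ 0 < h ord0, h ord_max < 1,
      (forall i j : 'I_N.+1, (i < j)%N -> h i < h j),
      eps / rho < h ord0 - (- h ord0) /\ eps / rho < (2 - h ord_max) - h ord_max &
      (forall i j : 'I_N.+1, nat_of_ord j = i.+1 -> eps / rho < h j - h i)].

Definition uh (R : realType) (N : nat) (eps : R)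
  (beta : ('I_N.+1 -> R) -> R -> R) (h : 'I_N.+1 -> R) (x : R) : R :=
  \sum_(i < N.+1) (-1) ^+ i * U ((x - h i) / eps) + beta h x.

Definition uhi (R : realType) (N : nat) (eps : R)
  (beta : ('I_N.+1 -> R) -> R -> R) (h : 'I_N.+1 -> R) (i : 'I_N.+1) (x : R) : R :=
  derive1 (fun t => uh eps beta (hupd h i t) x) (h i).

(* beta_N is an admissible correction: for h in Omega_rho, u^h(0) = -1,
   u^h satisfies Neumann conditions, and
   beta_N = ((-1)^N - 1)/2 + O(exp) together with its derivatives
   (in x and in each h_i), the exponentially small bound being
   K exp(-c/rho). *)
Definition beta_ok (R : realType) (N : nat) (eps rho K c : R)
  (beta : ('I_N.+1 -> R) -> R -> R) : Prop :=
  forall h : 'I_N.+1 -> R, in_Omega eps rho h ->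
  [/\ uh eps beta h 0 = -1,
      (derivable (uh eps beta h) 0 1 /\ derive1 (uh eps beta h) 0 = 0) /\
      (derivable (uh eps beta h) 1 1 /\ derive1 (uh eps beta h) 1 = 0),
      (forall x, 0 <= x <= 1 ->
         `|beta h x - ((-1) ^+ N - 1) / 2| <= K * expR (- c / rho)),
      (forall x, 0 <= x <= 1 ->
         derivable (beta h) x 1 /\ `|derive1 (beta h) x| <= K * expR (- c / rho)) &
      (forall (i : 'I_N.+1) x, 0 <= x <= 1 ->
         derivable (fun t => beta (hupd h i t) x) (h i) 1 /\
         `|derive1 (fun t => beta (hupd h i t) x) (h i)| <= K * expR (- c / rho))].

(* Main.v *)
(** Put [L = 1 / (2 rho)].  The intervals [|x - h_j| <= eps L] lie in [0,1] and
    are disjoint; let [chi_j = 1 - (x - h_j)^2 / (eps L)^2] there and 0 outside.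
    The extension of [chi_j v] by zero, rescaled around [h_j], is in H^1(R).
    After subtracting a constant [a] from [v] to make it orthogonal to [U'], the
    hypothesis on [lambda0] applies; expanding the square of the derivative with
    Young's inequality costs a factor [1 + d] with [d = lambda0 / 18], absorbed
    by passing from [lambda0] to [lambda0 / 2], plus [O(1 / L^2) = O(rho^2)]
    from [chi_j'].  The constant [a] is small since [v] is almost orthogonal to
    [U'((x - h_j) / eps)].  Where the cut-offs are not 1 one needs
    [f'(u^h) >= lambda0 / 2 - O(rho^2)], which follows from [f'(+-1) = 2] and
    [lambda0 <= 4]; the latter comes from the test function [x (3 - x)] on [0,3].
    Near [h_j] all other layers and [beta] add up to 0 up to [O(rho^2)].
    Of the exponential decay of [1 - U^2] only [y^4 (1 - U(y)^2) <= 24] is used. *)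
Require Import Defs.
From HB Require Import structures.
From mathcomp Require Import all_boot all_order all_algebra.
From mathcomp Require Import all_classical all_reals all_analysis.
From mathcomp Require Import measurable_realfun ring lra.
Import Order.TTheory GRing.Theory Num.Theory.
Import numFieldNormedType.Exports.
Local Open Scope classical_set_scope.
Local Open Scope ring_scope.

Local Notation mu := lebesgue_measure.

(** * Square-integrable functions *)

(** The spectral hypothesis concerns the whole line and asks for exact orthogonality. Correcting by
    a constant [a], rather than by a multiple of U', leaves V' unchanged, and chi (V - a) still
    vanishes where chi does, so its extension by zero stays in H^1. The price is a^2 times the
    length 2L of the interval. Hence a^2 has to be smaller than 1 / L^3, up to the exponentially
    small part from [beta]: the defect 1 - chi <= y^2 / L^2 and the fourth-order decay of U' give
    a^2 = O(1 / L^4) relative to the squared norm of V.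

    The squares of the cut-offs do not sum to 1. This is harmless: the gradient may be multiplied by
    chi^2 <= 1 and the rest dropped, while the missing part of the potential is supplied by f'(+-1)
    = 2.

    Young's inequality puts 1 + d on the gradient, which the norm of [v] cannot control. The
    potential therefore receives the same factor: the estimate is proved for 1 + d times the whole
    form, and the factor is removed at the end. *)

Definition bounded_measurable {R : realType} (D : set R) (h : R -> R) : Prop :=
  measurable_fun D h /\ exists M : R, forall x, D x -> `|h x| <= M.

Lemma bounded_measurableD {R : realType} (D : set R) (f g : R -> R) :
  bounded_measurable D f -> bounded_measurable D g ->
  bounded_measurable D (fun x => f x + g x).
Proof.
move=> [mf [M fM]] [mg [P gP]]; split; first exact: measurable_funD.
exists (M + P) => x Dx; apply: le_trans (ler_normD _ _) _.
by apply: lerD; [exact: fM|exact: gP].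
Qed.

Lemma bounded_measurableM {R : realType} (D : set R) (f g : R -> R) :
  bounded_measurable D f -> bounded_measurable D g ->
  bounded_measurable D (fun x => f x * g x).
Proof.
move=> [mf [M fM]] [mg [P gP]]; split; first exact: measurable_funM.
exists (M * P) => x Dx; rewrite normrM.
by apply: ler_pM => //; [exact: fM|exact: gP].
Qed.

Lemma bounded_measurable_cst {R : realType} (D : set R) (c : R) :
  bounded_measurable D (fun=> c).
Proof. by split; [exact: measurable_cst|exists `|c|]. Qed.

Lemma bounded_measurableN {R : realType} (D : set R) (f : R -> R) :
  bounded_measurable D f -> bounded_measurable D (fun x => - f x).
Proof.
move=> [mf [M fM]]; split; first exact: measurable_funN.
by exists M => x Dx; rewrite normrN; exact: fM.
Qed.

Lemma bounded_measurableX {R : realType} (D : set R) (f : R -> R) n :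
  bounded_measurable D f -> bounded_measurable D (fun x => f x ^+ n).
Proof.
move=> [mf [M fM]]; split; first exact: measurable_funX.
exists (M ^+ n) => x Dx; rewrite normrX; apply: lerXn2r; last exact: fM.
  by rewrite nnegrE.
by rewrite nnegrE; exact: le_trans (fM _ Dx).
Qed.

Lemma bounded_measurable_within {R : realType} (a b : R) (h : R -> R) :
  {within `[a, b], continuous h} -> bounded_measurable `[a, b] h.
Proof.
move=> ch; split; first by apply: subspace_continuous_measurable_fun.
have /compact_bounded[M [_ Mh]] := continuous_compact ch (@segment_compact _ a b).
by exists (M + 1) => x Dx; apply: (Mh (M + 1)); [rewrite ltrDl|exists x].
Qed.

Lemma bounded_measurable_continuous {R : realType} (a b : R) (h : R -> R) :
  continuous h -> bounded_measurable `[a, b] h.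
Proof.
by move=> ch; apply: bounded_measurable_within; exact: continuous_subspaceT.
Qed.

Lemma L2_integrableM {R : realType} (D : set (measurableTypeR R)) (f g : R -> R) :
  measurable D -> L2_on D f -> L2_on D g ->
  mu.-integrable D (EFin \o (fun x => f x * g x)).
Proof.
move=> mD [mf f2] [mg g2].
have if2 (h : R -> R) : measurable_fun D h -> (\int[leb R]_(x in D) ((h x) ^+ 2)%:E < +oo)%E ->
    mu.-integrable D (EFin \o (fun x => h x ^+ 2)).
  move=> mh h2; apply/integrableP; split.
    by apply/measurable_EFinP; exact: measurable_funX.
  by under eq_integral do rewrite /= ger0_norm ?sqr_ge0//.
apply: (@le_integrable _ _ _ _ _ mD _ (EFin \o (fun x => f x ^+ 2 + g x ^+ 2))).
- by apply/measurable_EFinP; exact: measurable_funM.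
- move=> x Dx /=; rewrite lee_fin (@ger0_norm _ (_ + _)) ?addr_ge0 ?sqr_ge0//.
  rewrite normrM -(real_normK (num_real (f x))) -(real_normK (num_real (g x))).
  have := normr_ge0 (f x); have := normr_ge0 (g x); nra.
- have := integrableD mD (if2 _ mf f2) (if2 _ mg g2).
  by apply: eq_integrable => //.
Qed.

Lemma L2_onM {R : realType} (D : set (measurableTypeR R)) (h f : R -> R) :
  measurable D -> bounded_measurable D h -> L2_on D f ->
  L2_on D (fun x => h x * f x).
Proof.
move=> mD [mh [M hM]] [mf f2]; split; first exact: measurable_funM.
apply: (@le_lt_trans _ _ (\int[mu]_(x in D) ((M ^+ 2)%:E * ((f x) ^+ 2)%:E))%E).
  apply: ge0_le_integral => //.
  - by move=> x _; rewrite lee_fin sqr_ge0.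
  - by apply/measurable_EFinP; apply: measurable_funX; exact: measurable_funM.
  - by apply: emeasurable_funM => //; apply/measurable_EFinP; exact: measurable_funX.
  - move=> x Dx; rewrite -EFinM lee_fin exprMn ler_wpM2r ?sqr_ge0//.
    by have := hM _ Dx; rewrite ler_norml => /andP[]; nra.
rewrite ge0_integralZl//; first by apply: lte_mul_pinfty => //; rewrite lee_fin sqr_ge0.
- by apply/measurable_EFinP; exact: measurable_funX.
- by move=> x _; rewrite lee_fin sqr_ge0.
- by rewrite lee_fin sqr_ge0.
Qed.

Lemma L2_onD {R : realType} (D : set (measurableTypeR R)) (f g : R -> R) :
  measurable D -> L2_on D f -> L2_on D g -> L2_on D (fun x => f x + g x).
Proof.
move=> mD Lf Lg.
have [mf f2] := Lf; have [mg g2] := Lg.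
split; first exact: measurable_funD.
have If : mu.-integrable D (EFin \o (fun x => f x * f x)) by exact: L2_integrableM.
have Ig : mu.-integrable D (EFin \o (fun x => g x * g x)) by exact: L2_integrableM.
have Ifg : mu.-integrable D (EFin \o (fun x => f x * g x)) by exact: L2_integrableM.
have /integrableP[_] := integrableD mD (integrableD mD If Ig) (integrableD mD Ifg Ifg).
apply: le_lt_trans; apply: ge0_le_integral => //.
- by move=> x _; rewrite lee_fin sqr_ge0.
- by apply/measurable_EFinP; apply: measurable_funX; exact: measurable_funD.
- apply: measurableT_comp => //=; apply: measurable_int.
  exact: (integrableD mD (integrableD mD If Ig) (integrableD mD Ifg Ifg)).
- move=> x Dx /=; rewrite lee_fin; apply: le_trans (ler_norm _).
  by rewrite [leLHS](_ : _ = f x * f x + g x * g x + (f x * g x + f x * g x))//; ring.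
Qed.

Lemma bounded_measurable_L2 {R : realType} (D : set (measurableTypeR R)) (h : R -> R) :
  measurable D -> (mu D < +oo)%E -> bounded_measurable D h -> L2_on D h.
Proof.
move=> mD Doo [mh [M hM]]; split => //.
have : mu.-integrable D (EFin \o (fun x => h x ^+ 2)).
  apply: measurable_bounded_integrable => //; first exact: measurable_funX.
  exists (M ^+ 2); split; first exact: num_real.
  move=> y My x Dx; rewrite /= normrX; apply: le_trans (ltW My).
  by apply: lerXn2r; rewrite ?nnegrE //; [exact: le_trans (hM _ Dx)|exact: hM].
move=> /integrableP[_]; apply: le_lt_trans.
by under [leRHS]eq_integral do rewrite /= ger0_norm ?sqr_ge0//.
Qed.

Lemma L2_onS {R : realType} (D E : set R) (f : R -> R) :
  measurable D -> measurable E -> D `<=` E -> L2_on E f -> L2_on D f.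
Proof.
move=> mD mE DE [mf f2]; split; first exact: measurable_funS mf.
apply: le_lt_trans f2; apply: ge0_subset_integral => //.
- by apply/measurable_EFinP; exact: measurable_funX.
- by move=> x _; rewrite lee_fin sqr_ge0.
Qed.

Lemma itv_lty {R : realType} (a b : R) : (mu (`[a, b] : set R) < +oo)%E.
Proof. by rewrite lebesgue_measure_itv/=; case: ifP => // _; rewrite -EFinB ltry. Qed.

(** * Finite linear combinations of integrands *)

Definition lincomb {R : realType} {T : Type} (s : seq (R * (T -> R))) (x : T) : R :=
  foldr (fun p y => p.1 * p.2 x + y) 0 s.

Definition all_integrable {R : realType} (D : set (measurableTypeR R)) (s : seq (R * (R -> R))) : Prop :=
  foldr (fun p P => mu.-integrable D (EFin \o p.2) /\ P) True s.

Lemma integrable_lincomb {R : realType} (D : set (measurableTypeR R)) (s : seq (R * (R -> R))) :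
  measurable D -> all_integrable D s -> mu.-integrable D (EFin \o lincomb s).
Proof.
move=> mD; elim: s => [_|[c h] s IH [/= ih /IH ints]]; first exact: integrable0.
by apply: eq_integrable (integrableD mD (integrableZl mD c ih) ints).
Qed.

Lemma Rintegral_lincomb {R : realType} (D : set (measurableTypeR R)) (s : seq (R * (R -> R))) :
  measurable D -> all_integrable D s ->
  \int[mu]_(x in D) lincomb s x =
  foldr (fun p y => p.1 * \int[mu]_(x in D) p.2 x + y) 0 s.
Proof.
move=> mD; elim: s => [_|[c h] s IH [/= ih ints]].
  by rewrite /lincomb /= Rintegral_cst// mul0r.
rewrite [LHS]RintegralD//.
- by rewrite RintegralZl// IH.
- exact: eq_integrable (integrableZl mD c ih).
- exact: integrable_lincomb.
Qed.

(** This form reduces an estimate with several error terms to one pointwise inequality, with the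
    coefficients already outside the integrals and integrability checked entry by entry. *)
Lemma le_Rintegral_lincomb {R : realType} (D : set (measurableTypeR R))
    (f : R -> R) (s : seq (R * (R -> R))) :
  measurable D -> mu.-integrable D (EFin \o f) -> all_integrable D s ->
  (forall x, D x -> f x <= lincomb s x) ->
  \int[mu]_(x in D) f x <= foldr (fun p y => p.1 * \int[mu]_(x in D) p.2 x + y) 0 s.
Proof.
move=> mD fi si fs; rewrite -Rintegral_lincomb//; apply: le_Rintegral => //.
exact: integrable_lincomb.
Qed.

Lemma L2_integrable_sqr {R : realType} (D : set (measurableTypeR R)) (f : R -> R) :
  measurable D -> L2_on D f -> mu.-integrable D (EFin \o (fun x => f x ^+ 2)).
Proof.
move=> mD Lf; apply: eq_integrable (L2_integrableM _ _ _ mD Lf Lf) => //.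
Qed.

Lemma cauchy_schwarz_L2 {R : realType} (D : set (measurableTypeR R)) (f g : R -> R) :
  measurable D -> L2_on D f -> L2_on D g ->
  (\int[mu]_(x in D) (f x * g x)) ^+ 2 <=
  \int[mu]_(x in D) (f x ^+ 2) * \int[mu]_(x in D) (g x ^+ 2).
Proof.
move=> mD Lf Lg.
have If := L2_integrable_sqr _ _ mD Lf.
have Ig := L2_integrable_sqr _ _ mD Lg.
have Ifg := L2_integrableM _ _ _ mD Lf Lg.
set A := \int[mu]_(x in D) (f x ^+ 2).
set B := \int[mu]_(x in D) (f x * g x).
set C := \int[mu]_(x in D) (g x ^+ 2).
have A0 : 0 <= A by apply: Rintegral_ge0 => x _; exact: sqr_ge0.
have quad t : 0 <= t ^+ 2 * A + (2 * t * B + C).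
  have := @Rintegral_lincomb R D [:: (t ^+ 2, fun x => f x ^+ 2);
    (2 * t, fun x => f x * g x); (1, fun x => g x ^+ 2)] mD.
  rewrite /= mul1r addr0 -/A -/B -/C => <- //; apply: Rintegral_ge0 => x _.
  rewrite /lincomb /= [X in 0 <= X](_ : _ = (t * f x + g x) ^+ 2) ?sqr_ge0//; ring.
have [A_eq0|A_neq0] := eqVneq A 0.
  have [->|B0] := eqVneq B 0; first by rewrite expr0n /= A_eq0 mul0r.
  (* In the degenerate case the quadratic is affine in [t]; at this [t] its value is -1. *)
  have := quad (- (C + 1) / (2 * B)); rewrite A_eq0 mulr0 add0r.
  have -> : 2 * (- (C + 1) / (2 * B)) * B = - (C + 1) by field.
  by move=> ?; exfalso; lra.
have A_gt0 : 0 < A by rewrite lt_neqAle eq_sym A_neq0.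
have := quad (- B / A).
have -> : (- B / A) ^+ 2 * A + (2 * (- B / A) * B + C) = (A * C - B ^+ 2) / A by field.
by rewrite pmulr_lge0 ?invr_gt0// subr_ge0.
Qed.

Lemma Rintegral_FTC {R : realType} (F f : R -> R) (a b : R) :
  a <= b -> (forall x : R, is_derive x 1 F (f x)) -> continuous f ->
  \int[mu]_(x in `[a, b]) f x = F b - F a.
Proof.
rewrite le_eqVlt => /predU1P[<-|ab] dF cf.
  by rewrite set_itv1 Rintegral_set1 subrr.
have cF : continuous F.
  by move=> x; apply: differentiable_continuous; apply/derivable1_diffP; case: (dF x).
rewrite /Rintegral (@continuous_FTC2 _ f F)//.
- exact: continuous_subspaceT.
- split.
  + by move=> x _; case: (dF x).
  + by apply: cvg_at_right_filter; exact: cF.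
  + by apply: cvg_at_left_filter; exact: cF.
- by move=> x _; rewrite derive1E; apply: derive_val.
Qed.

(** * Affine changes of variables and extension by zero *)

Lemma continuous_affine {R : realType} (e p : R) : continuous (fun y : R => p + e * y).
Proof.
move=> x; apply: cvgD; first exact: cvg_cst.
by apply: cvgM; [exact: cvg_cst|exact: cvg_id].
Qed.

Lemma measurable_affine {R : realType} (e p : R) (D : set R) :
  measurable_fun D (fun y : R => p + e * y).
Proof.
apply: (@measurable_funS _ _ _ _ setT) => //.
by apply: continuous_measurable_fun; exact: continuous_affine.
Qed.

(** The pushforward under y -> p + e y, scaled by [e], gives half-open intervals their length, and
    this determines Lebesgue measure. *)
Lemma lebesgue_measure_affine {R : realType} (e p : R) (A : set (measurableTypeR R)) :
  0 < e -> measurable A ->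
  mu A = (e%:E * mu ((fun y : R => p + e * y)%R @^-1` A))%E.
Proof.
move=> e0 mA; pose phi y := p + e * y.
have mphi : measurable_fun (setT : set (measurableTypeR R)) (phi : R -> measurableTypeR R).
  exact: measurable_affine.
pose phim : {mfun measurableTypeR R >-> measurableTypeR R} :=
  HB.pack phi (isMeasurableFun.Build _ _ _ _ _ mphi).
have := @lebesgue_measure_unique R (mscale (NngNum (ltW e0)) (pushforward mu phim)).
apply => // X [[a b] _ <-] /=.
rewrite /mscale /= /pushforward.
have -> : (phi : R -> R) @^-1` `]a, b] = `](a - p) / e, (b - p) / e]%classic.
  apply/seteqP; split => y /=; rewrite /phi !in_itv /= ltr_pdivrMr// ler_pdivlMr//;
    rewrite ltrBlDl lerBrDl (mulrC y); exact.
rewrite !lebesgue_measure_itv /= !lte_fin ltr_pM2r ?invr_gt0// ltrD2r.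
case: ifP => _; last by rewrite mule0.
by rewrite -!EFinB -EFinM; congr EFin; field; rewrite gt_eqF.
Qed.

Lemma measurable_preimage_affine {R : realType} (e p : R) (D : set (measurableTypeR R)) :
  measurable D -> measurable ((fun y : R => p + e * y)%R @^-1` D : set (measurableTypeR R)).
Proof.
move=> mD; rewrite -[X in measurable X]setTI.
suff : measurable_fun (setT : set (measurableTypeR R)) (fun y => p + e * y : measurableTypeR R).
  by apply.
exact: measurable_affine.
Qed.

Lemma ge0_integral_affine {R : realType} (e p : R) (D : set (measurableTypeR R)) (f : R -> \bar R) :
  0 < e -> measurable D -> measurable_fun D f -> (forall x, 0 <= f x)%E ->
  (\int[mu]_(x in D) f x =
  e%:E * \int[mu]_(y in (fun y : R => p + e * y)%R @^-1` D) f (p + e * y)%R)%E.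
Proof.
move=> e0 mD mf f0; pose phi y := p + e * y.
have mphi : measurable_fun (setT : set (measurableTypeR R)) (phi : R -> measurableTypeR R).
  exact: measurable_affine.
pose phim : {mfun measurableTypeR R >-> measurableTypeR R} :=
  HB.pack phi (isMeasurableFun.Build _ _ _ _ _ mphi).
rewrite (eq_measure_integral (mscale (NngNum (ltW e0)) (pushforward mu phim))); last first.
  by move=> A mA _; exact: lebesgue_measure_affine.
rewrite ge0_integral_mscale//=; congr (_ * _)%E.
by rewrite ge0_integral_pushforward.
Qed.

Lemma integrable_affine {R : realType} (e p : R) (D : set (measurableTypeR R)) (f : R -> R) :
  0 < e -> measurable D -> mu.-integrable D (EFin \o f) ->
  mu.-integrable ((fun y : R => p + e * y)%R @^-1` D) (EFin \o (fun y => f (p + e * y))).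
Proof.
move=> e0 mD /integrableP[mf foo]; apply/integrableP; split.
  apply/measurable_EFinP; move/measurable_EFinP : mf => mf.
  apply: (@measurable_comp _ _ _ _ _ _ D f) => //.
    by move=> _ [y Dy <-].
  exact: measurable_affine.
move: foo; rewrite (@ge0_integral_affine _ e p)//; last exact: measurableT_comp.
by rewrite -lte_pdivlMl// => /lt_le_trans; apply; rewrite leey.
Qed.

Lemma Rintegral_affine {R : realType} (e p : R) (D : set (measurableTypeR R)) (f : R -> R) :
  0 < e -> measurable D -> mu.-integrable D (EFin \o f) ->
  \int[mu]_(x in D) f x =
  e * \int[mu]_(y in (fun y : R => p + e * y) @^-1` D) f (p + e * y).
Proof.
move=> e0 mD fi.
have mf := measurable_int _ fi.
have gi := @integrable_affine _ e p _ _ e0 mD fi.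
have mpre := @measurable_preimage_affine _ e p _ mD.
rewrite /Rintegral (_ : e * _ = fine (e%:E *
    \int[mu]_(y in (fun y : R => p + e * y)%R @^-1` D) (f (p + e * y)%R)%:E)%E); last first.
  by rewrite fineM//; exact: integrable_fin_num gi.
(* The substitution is established for nonnegative integrands, so it is applied to the positive and
   the negative part, both of which commute with composition. *)
congr fine; rewrite integralE [in RHS]integralE muleBr//; last first.
  rewrite fin_num_adde_defl// fin_numN; apply: integrable_neg_fin_num => //.
congr (_ - _)%E.
- under [in RHS]eq_integral do rewrite (funepos_comp (EFin \o f)).
  exact: (@ge0_integral_affine _ e p D ((EFin \o f)^\+)%E e0 mD (measurable_funepos mf) (fun=> funepos_ge0 _ _)).
- under [in RHS]eq_integral do rewrite (funeneg_comp (EFin \o f)).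
  exact: (@ge0_integral_affine _ e p D ((EFin \o f)^\-)%E e0 mD (measurable_funeneg mf) (fun=> funeneg_ge0 _ _)).
Qed.

Lemma preimage_affine_itv {R : realType} (e p a b : R) : 0 < e ->
  (fun y : R => p + e * y) @^-1` `[p + e * a, p + e * b] = `[a, b]%classic.
Proof.
move=> e0; apply/seteqP; split => y /=; rewrite !in_itv /= !lerD2l !ler_pM2l//.
Qed.

Lemma Rintegral_affine_itv {R : realType} (e p a b : R) (f : R -> R) : 0 < e ->
  mu.-integrable `[p + e * a, p + e * b] (EFin \o f) ->
  \int[mu]_(y in `[a, b]) f (p + e * y) =
  e^-1 * \int[mu]_(x in `[p + e * a, p + e * b]) f x.
Proof.
move=> e0 fi; rewrite (@Rintegral_affine _ e p _ f e0 (measurable_itv _) fi).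
rewrite (@preimage_affine_itv _ e p a b e0).
by rewrite mulKf// gt_eqF.
Qed.

Lemma L2_on_affine_itv {R : realType} (e p a b : R) (f : R -> R) : 0 < e ->
  L2_on `[p + e * a, p + e * b] f -> L2_on `[a, b] (fun y => f (p + e * y)).
Proof.
move=> e0 Lf; rewrite -(@preimage_affine_itv _ e p)//; split.
  have [mf _] := Lf.
  apply: (@measurable_comp _ _ _ _ _ _ (`[p + e * a, p + e * b] : set (measurableTypeR R)) f) => //.
    by move=> _ [y Dy <-].
  exact: measurable_affine.
have /integrableP[_] := @integrable_affine _ e p `[p + e * a, p + e * b] _ e0 (measurable_itv _)
  (L2_integrable_sqr _ _ (measurable_itv _) Lf).
by apply: le_lt_trans; under [leRHS]eq_integral do rewrite /= ger0_norm ?sqr_ge0//.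
Qed.

Lemma L2_on_restrict {R : realType} (D : set (measurableTypeR R)) (f : R -> R) :
  measurable D -> L2_on D f -> L2_on setT (f \_ D).
Proof.
move=> mD [mf f2]; split; first by apply/measurable_restrict => //; rewrite setTI.
move: f2; rewrite integral_mkcond; apply: le_lt_trans.
rewrite le_eqVlt; apply/orP; left; apply/eqP; apply: eq_integral => x _ /=.
by rewrite !patchE; case: ifP => //; rewrite expr0n.
Qed.

Lemma Rintegral_itv_diff {R : realType} (a b p q : R) (f : R -> R) :
  mu.-integrable `[a, b] (EFin \o f) -> a <= p -> p <= q -> q <= b ->
  \int[mu]_(x in `[a, q]) f x - \int[mu]_(x in `[a, p]) f x = \int[mu]_(x in `[p, q]) f x.
Proof.
move=> fi ap pq qb; rewrite Rintegral_itvB ?bnd_simp//; last first.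
  by apply: integrableS fi => //; apply: subset_itvl; rewrite bnd_simp.
rewrite Rintegral_itv_obnd_cbnd//; apply: integrableS fi => //.
by apply: subset_itv; rewrite bnd_simp.
Qed.

(** The formula for [F] at [a] forces [F a = 0], so together with [F b = 0] the extension has no
    jump. [H1_line] anchors its primitive at 0, whence [a <= 0 <= b] and the four cases: beyond [b]
    the integral of [DF] over [0, b] is [- F 0], and before [a] the one over [a, 0] is [F 0]. *)
Lemma H1_line_restrict {R : realType} (a b : R) (F DF : R -> R) :
  a <= 0 -> 0 <= b -> L2_on `[a, b] F -> L2_on `[a, b] DF ->
  mu.-integrable `[a, b] (EFin \o DF) ->
  (forall x, a <= x <= b -> F x = \int[mu]_(t in `[a, x]) DF t) -> F b = 0 ->
  H1_line (F \_ `[a, b]) (DF \_ `[a, b]).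
Proof.
move=> a0 b0 LF LDF iDF FE Fb.
split; first exact: L2_on_restrict.
split; first exact: L2_on_restrict.
have F0 : (F \_ `[a, b]) 0 = F 0.
  by rewrite patchE mem_set//= in_itv /= a0 b0.
move=> x; rewrite F0 /int_from0.
have [x0|x0] := leP 0 x; rewrite -Rintegral_mkcondr.
- have [xb|bx] := leP x b.
    rewrite (_ : _ `&` _ = `[0, x]%classic); last first.
      apply/seteqP; split => y /=; rewrite !in_itv /=; first by case.
      by move=> /andP[y0 yx]; rewrite y0 yx (le_trans a0 y0) (le_trans yx xb).
    rewrite patchE mem_set /= ?in_itv /= ?xb ?(le_trans a0 x0)//.
    rewrite -(@Rintegral_itv_diff _ a b) //.
    by rewrite FE ?(le_trans a0 x0)// (FE 0) ?a0// addrC subrK.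
  rewrite (_ : _ `&` _ = `[0, b]%classic); last first.
    apply/seteqP; split => y /=; rewrite !in_itv /=.
      by move=> [/andP[-> _] /andP[_ ->]].
    by move=> /andP[y0 yb]; rewrite y0 yb (le_trans a0 y0) (le_trans yb (ltW bx)).
  rewrite patchE memNset /= ?in_itv /=; last by rewrite (leNgt x b) bx andbF.
  rewrite -(@Rintegral_itv_diff _ a b) //.
  by rewrite (FE 0) ?a0// addrC subrK -FE ?Fb// lexx (le_trans a0 b0).
- have [ax|xa] := leP a x.
    rewrite (_ : _ `&` _ = `[x, 0]%classic); last first.
      apply/seteqP; split => y /=; rewrite !in_itv /=; first by case.
      by move=> /andP[xy y0]; rewrite xy y0 (le_trans ax xy) (le_trans y0 b0).
    rewrite patchE mem_set /= ?in_itv /= ?ax ?(le_trans (ltW x0) b0)//.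
    rewrite -(@Rintegral_itv_diff _ a b) ?(ltW x0)//.
    by rewrite FE ?ax ?(le_trans (ltW x0) b0)// (FE 0) ?a0// opprB addrC subrK.
  rewrite (_ : _ `&` _ = `[a, 0]%classic); last first.
    apply/seteqP; split => y /=; rewrite !in_itv /=.
      by move=> [/andP[_ ->] /andP[-> _]].
    by move=> /andP[ay y0]; rewrite y0 ay (le_trans (ltW xa) ay) (le_trans y0 b0).
  rewrite patchE memNset /= ?in_itv /=; last by rewrite (leNgt a x) xa.
  by rewrite (FE 0) ?a0// subrr.
Qed.

(** * The product rule for primitives of integrable functions *)

Lemma integrable_prodM {R : realType} (f g : R -> R) :
  mu.-integrable setT (EFin \o f) -> mu.-integrable setT (EFin \o g) ->
  (mu \x mu)%E.-integrable setT (fun p : measurableTypeR R * measurableTypeR R => (f p.1 * g p.2)%:E).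
Proof.
move=> fi gi.
have mf : measurable_fun setT f by move/measurable_int : fi => /measurable_EFinP.
have mg : measurable_fun setT g by move/measurable_int : gi => /measurable_EFinP.
have mh : measurable_fun setT (fun p : measurableTypeR R * measurableTypeR R => (f p.1 * g p.2)%:E).
  apply/measurable_EFinP; apply: measurable_funM.
  - exact: measurableT_comp mf measurable_fst.
  - exact: measurableT_comp mg measurable_snd.
apply/(integrable12ltyP mu mu mh).
move: fi gi => /integrableP[_ foo] /integrableP[_ goo].
rewrite (_ : (\int[mu]_x _)%E =
    (\int[mu]_x (`|(f x)%:E| * \int[mu]_y `|(g y)%:E|))%E); last first.
  apply: eq_integral => x _ /=; rewrite -ge0_integralZl//.
  - by apply: eq_integral => y _; rewrite normrM EFinM.
  - by apply/measurable_EFinP; exact: measurableT_comp.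
have [c c0 ->] : exists2 c : R, 0 <= c & (\int[mu]_y `|(g y)%:E| = c%:E)%E.
  have g0 : (0 <= \int[mu]_y `|(g y)%:E|)%E by exact: integral_ge0.
  by exists (fine (\int[mu]_y `|(g y)%:E|)%E); rewrite ?fine_ge0// fineK// ge0_fin_numE.
rewrite ge0_integralZr//.
- by rewrite muleC; apply: lte_mul_pinfty.
- by apply/measurable_EFinP; exact: measurableT_comp.
Qed.

Lemma integrable_patch {R : realType} (D : set (measurableTypeR R)) (f : R -> R) :
  measurable D -> mu.-integrable D (EFin \o f) -> mu.-integrable setT (EFin \o (f \_ D)).
Proof.
move=> mD fi; rewrite -restrict_EFin; apply/integrable_restrict => //.
by rewrite setTI.
Qed.

Lemma integrable_bounded_measurableM {R : realType} (D : set (measurableTypeR R)) (h f : R -> R) :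
  measurable D -> bounded_measurable D h -> mu.-integrable D (EFin \o f) ->
  mu.-integrable D (EFin \o (fun x => h x * f x)).
Proof.
move=> mD [mh [M hM]] fi.
have bh : [bounded h x | x in D].
  by exists M; split; [exact: num_real|move=> y My x /hM hx; exact: le_trans hx (ltW My)].
exact: (@integrableMr _ _ _ mu D mD h (EFin \o f) mh bh fi).
Qed.

Lemma EFin_Rintegral {R : realType} (D : set (measurableTypeR R)) (f : R -> R) :
  measurable D -> mu.-integrable D (EFin \o f) ->
  (\int[mu]_(x in D) (f x)%:E = (\int[mu]_(x in D) f x)%R%:E)%E.
Proof. by move=> mD fi; rewrite /Rintegral fineK//; exact: integrable_fin_num fi. Qed.

(** Both iterated integrals integrate g(s) f(t) over the triangle a <= s <= t <= x, so Fubini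
    applies. The integrability claims are recorded because the product rule adds these integrands to
    others. *)
Lemma Rintegral_triangle {R : realType} (a x : R) (f g : R -> R) :
  a <= x -> mu.-integrable `[a, x] (EFin \o f) -> mu.-integrable `[a, x] (EFin \o g) ->
  mu.-integrable `[a, x] (EFin \o (fun s => g s * \int[mu]_(t in `[s, x]) f t)) /\
  mu.-integrable `[a, x] (EFin \o (fun t => f t * \int[mu]_(s in `[a, t]) g s)) /\
  \int[mu]_(s in `[a, x]) (g s * \int[mu]_(t in `[s, x]) f t) =
  \int[mu]_(t in `[a, x]) (f t * \int[mu]_(s in `[a, t]) g s).
Proof.
move=> ax fi gi; set D := `[a, x]%classic.
have mD : measurable (D : set (measurableTypeR R)) by exact: measurable_itv.
pose P := [set p : measurableTypeR R * measurableTypeR R | p.1 <= p.2].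
have mP : measurable P.
  have := @measurable_fun_ler _ (measurableTypeR R * measurableTypeR R)%type R setT fst snd
    measurable_fst measurable_snd.
  move=> /(_ measurableT [set true]); rewrite setTI; apply.
  by [].
(* After extension by zero to the line, only the indicator of s <= t couples the two variables. *)
pose Phi := fun p : measurableTypeR R * measurableTypeR R =>
   ((g \_ D) p.1 * (f \_ D) p.2 * \1_P p)%:E.
have gT := integrable_patch _ _ mD gi.
have fT := integrable_patch _ _ mD fi.
have iPhi : (mu \x mu)%E.-integrable setT Phi.
  have igf := integrable_prodM _ _ gT fT.
  apply: (le_integrable _ _ _ igf) => //.
  - apply/measurable_EFinP; apply: measurable_funM.
      by move/measurable_int : igf => /measurable_EFinP.
    exact: measurable_indic.
  - move=> p _ /=; rewrite lee_fin normrM ler_piMr// indicE.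
    by case: (_ \in _); rewrite ?normr1 ?normr0.
have in1 s : (\int[mu]_t Phi (s, t) = (((fun s => g s * \int[mu]_(t in `[s, x]) f t) \_ D) s)%:E)%E.
  rewrite patchE; case: ifPn => sD; last first.
    by apply: integral0_eq => t _; rewrite /Phi /= patchE (negbTE sD) !mul0r.
  have : s \in D by []. rewrite inE /D /= in_itv /= => /andP[as_ sx].
  have fsx : mu.-integrable `[s, x] (EFin \o f).
    by apply: integrableS fi => //; apply: subset_itv; rewrite bnd_simp.
  rewrite EFinM -EFin_Rintegral// -integralZl// [RHS]integral_mkcond.
  apply: eq_integral => t _; rewrite /Phi /= !patchE sD indicE /P.
  have -> : (t \in `[s, x]%classic) = (t \in D) && ((s, t) \in P).
    apply/idP/andP; rewrite !inE /D /P /= !in_itv /=.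
      by move=> /andP[st tx]; rewrite (le_trans as_ st) tx st.
    by move=> [/andP[_ ->] ->].
  by case: (t \in D); case: ((s, t) \in P) => /=; rewrite ?mulr0 ?mulr1 ?mul0r -?EFinM.
have in2 t : (\int[mu]_s Phi (s, t) = (((fun t => f t * \int[mu]_(s in `[a, t]) g s) \_ D) t)%:E)%E.
  rewrite patchE; case: ifPn => tD; last first.
    by apply: integral0_eq => s _; rewrite /Phi /= [X in _ * X * _]patchE (negbTE tD) mulr0 mul0r.
  have : t \in D by []. rewrite inE /D /= in_itv /= => /andP[at_ tx].
  have gat : mu.-integrable `[a, t] (EFin \o g).
    by apply: integrableS gi => //; apply: subset_itv; rewrite bnd_simp.
  rewrite EFinM -EFin_Rintegral// -integralZl// [RHS]integral_mkcond.
  apply: eq_integral => s _; rewrite /Phi /= !patchE tD indicE /P.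
  have -> : (s \in `[a, t]%classic) = (s \in D) && ((s, t) \in P).
    apply/idP/andP; rewrite !inE /D /P /= !in_itv /=.
      by move=> /andP[as_ st]; rewrite as_ (le_trans st tx) st.
    by move=> [/andP[-> _] ->].
  by case: (s \in D); case: ((s, t) \in P) => /=; rewrite ?mulr0 ?mulr1 ?mul0r -?EFinM// mulrC.
have F1 : fubini_F mu Phi = EFin \o ((fun s => g s * \int[mu]_(t in `[s, x]) f t) \_ D).
  by apply/funext => s; exact: in1.
have := integrable_fubini_F iPhi; rewrite F1 -restrict_EFin.
move=> iT; have i1 : mu.-integrable D (EFin \o (fun s => g s * \int[mu]_(t in `[s, x]) f t)).
  by move/(integrable_restrict _ mD) : iT; rewrite setTI; apply.
have i2 : mu.-integrable D (EFin \o (fun t => f t * \int[mu]_(s in `[a, t]) g s)).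
  rewrite (_ : (fun t => _) = fun t => \int[mu]_(s in `[a, t]) g s * f t); last first.
    by apply/funext => t; rewrite mulrC.
  apply: integrable_bounded_measurableM => //; apply: bounded_measurable_within.
  exact: parameterized_integral_continuous.
split; first exact: i1.
split; first exact: i2.
apply: EFin_inj; rewrite -!EFin_Rintegral//.
rewrite integral_mkcond [RHS]integral_mkcond.
transitivity (\int[mu]_s \int[mu]_t Phi (s, t))%E.
  by apply: eq_integral => s _; rewrite in1 !patchE; case: ifP.
etransitivity; first exact: (Fubini iPhi).
apply: eq_integral => t _; etransitivity; first exact: in2.
by rewrite !patchE; case: ifP.
Qed.

(** Since [g] is merely integrable, its primitive need not be differentiable everywhere and
    classical integration by parts is not at hand. Instead c(x) = c(t) + int_t^x c' is inserted
    under the integral of [g], and the order of the resulting double integral is exchanged. *)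
Lemma Rintegral_product_rule {R : realType} (a x : R) (c c' g : R -> R) :
  a <= x -> (forall t : R, is_derive t 1 c (c' t)) -> continuous c' ->
  mu.-integrable `[a, x] (EFin \o g) ->
  c x * \int[mu]_(t in `[a, x]) g t =
  \int[mu]_(t in `[a, x]) (c t * g t + c' t * \int[mu]_(s in `[a, t]) g s).
Proof.
move=> ax dc cc' gi.
have cc : continuous c.
  by move=> y; apply: differentiable_continuous; apply/derivable1_diffP; case: (dc y).
have c'i : mu.-integrable `[a, x] (EFin \o c').
  by apply: continuous_compact_integrable; [exact: segment_compact|exact: continuous_subspaceT].
have [i1 [i2 E]] := Rintegral_triangle _ _ _ _ ax c'i gi.
have cgi : mu.-integrable `[a, x] (EFin \o (fun t => c t * g t)).
  by apply: integrable_bounded_measurableM => //; exact: bounded_measurable_continuous.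
rewrite RintegralD// -E -RintegralD//.
rewrite -RintegralZl//; apply: eq_Rintegral => t; rewrite inE /= in_itv /= => /andP[at_ tx].
by rewrite (Rintegral_FTC c c')//; ring.
Qed.

(** * The heteroclinic profile *)

Lemma tanhN {R : realType} (z : R) : tanh (- z) = - tanh z.
Proof. by rewrite /tanh opprK -opprB mulNr [expR (- z) + _]addrC. Qed.

Lemma UN {R : realType} (x : R) : U (- x) = - U x.
Proof. by rewrite /U mulNr tanhN. Qed.

Lemma one_sub_tanh2 {R : realType} (z : R) :
  1 - tanh z ^+ 2 = 4 / (expR z + expR (- z)) ^+ 2.
Proof.
have E0 := expR_gt0 z; rewrite /tanh expRN; field.
by rewrite !gt_eqF// ltr_wpDl// sqr_ge0.
Qed.

Lemma one_sub_U2_ge0 {R : realType} (x : R) : 0 <= 1 - U x ^+ 2.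
Proof. by rewrite /U one_sub_tanh2 divr_ge0// sqr_ge0. Qed.

Lemma U_ge0 {R : realType} (x : R) : 0 <= x -> 0 <= U x.
Proof.
move=> x0; rewrite /U /tanh; apply: divr_ge0; last by rewrite addr_ge0 ?expR_ge0.
have z0 : 0 <= x / Num.sqrt 2 by rewrite divr_ge0// sqrtr_ge0.
by rewrite subr_ge0 ler_expR; lra.
Qed.

Lemma U_le1 {R : realType} (x : R) : `|U x| <= 1.
Proof.
by have := one_sub_U2_ge0 x; rewrite ler_norml => ?; apply/andP; split; nra.
Qed.

(** For x >= 0 put z = x / sqrt 2: then x^4 = 4 z^4 and 1 - U^2 <= 4 e^(-2z). The constant is 4!,
    from e^(2z) >= (2z)^4 / 4!. *)
Lemma one_sub_U2_decay {R : realType} (x : R) : x ^+ 4 * (1 - U x ^+ 2) <= 24.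
Proof.
wlog x0 : x / 0 <= x.
  move=> H; have [x0|x0] := leP 0 x; first exact: H.
  have := H (- x); rewrite UN sqrrN (_ : (- x) ^+ 4 = x ^+ 4); last by ring.
  by rewrite oppr_ge0; apply; exact: ltW.
rewrite /U one_sub_tanh2; set z := x / Num.sqrt 2.
have z0 : 0 <= z by rewrite divr_ge0// sqrtr_ge0.
have x4 : x ^+ 4 = 4 * z ^+ 4.
  have s2 : Num.sqrt 2 ^+ 2 = 2 :> R by rewrite sqr_sqrtr.
  have s0 : 0 < Num.sqrt 2 :> R by rewrite sqrtr_gt0.
  rewrite /z expr_div_n [in RHS](_ : Num.sqrt 2 ^+ 4 = 4); first by field.
  by rewrite (_ : 4 = 2 * 2)%N // exprM s2; ring.
have E0 := expR_gt0 z; have E1 := expR_gt0 (- z).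
rewrite x4 mulrA ler_pdivrMr ?exprn_gt0 ?addr_gt0//.
have := @expR_ge1Dxn R (2 * z) 3 (mulr_ge0 _ z0); rewrite ler0n => /(_ isT).
rewrite (_ : 2 * z = z + z); last by ring.
rewrite expRD (_ : 4`! = 24)%N// (_ : (z + z) ^+ 4 = 16 * z ^+ 4); last by ring.
have := exprn_ge0 4 z0.
set E := expR z in E0 *; set F := expR (- z) in E1 *.
nra.
Qed.

Lemma one_sub_U2_lower {R : realType} :
  exists2 s : R, 0 < s & forall x : R, `|x| <= 1 -> s <= 1 - U x ^+ 2.
Proof.
(* For |x| <= 1 also |z| <= 1, so e^z + e^(-z) <= 2e, and 4 / (2e)^2 = e^(-2). *)
exists ((expR 1) ^- 2); first by rewrite invr_gt0 exprn_gt0// expR_gt0.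
move=> x x1; rewrite /U one_sub_tanh2; set z := x / _.
have s1 : 1 <= Num.sqrt 2 :> R by rewrite -[leLHS]sqrtr1 ler_sqrt// ler1n.
have : `|z| <= 1.
  rewrite normrM normfV (ger0_norm (sqrtr_ge0 _)) ler_pdivrMr ?mul1r; last exact: lt_le_trans s1.
  exact: le_trans s1.
rewrite ler_norml => /andP[zN z1].
have e1 : expR z <= expR 1 by rewrite ler_expR.
have e2 : expR (- z) <= expR 1 by rewrite ler_expR lerNl.
have e3 := expR_gt0 z; have e4 := expR_gt0 (- z); have e5 := expR_gt0 (1 : R).
rewrite ler_pdivlMr ?exprn_gt0 ?addr_gt0// mulrC ler_pdivrMr ?exprn_gt0//.
nra.
Qed.

Lemma is_derive_tanh {R : realType} (z : R) : is_derive z 1 (@tanh R) (1 - tanh z ^+ 2).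
Proof.
have dN : is_derive z 1 (fun y : R => expR (- y)) (- expR (- z)).
  have := @is_derive1_comp R expR -%R z (expR (- z)) (-1) _ _.
  by rewrite mulrN1; apply.
have p : expR z + expR (- z) != 0 by rewrite gt_eqF// addr_gt0// expR_gt0.
have dP : is_derive z 1 (fun y : R => expR y + expR (- y)) (expR z - expR (- z)).
  exact: is_deriveD.
have dM : is_derive z 1 (fun y : R => expR y - expR (- y)) (expR z + expR (- z)).
  have := @is_deriveB R R R expR (fun y => expR (- y)) z 1 (expR z) (- expR (- z)) _ dN.
  by rewrite opprK; apply.
have dV := @is_deriveV R (fun y : R => expR y + expR (- y)) z _ (1 : R) p dP.
have := @is_deriveM R R _ _ z 1 _ _ dM dV.
move=> H; apply: is_derive_eq H _; rewrite /= /GRing.scale /= /tanh; field.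
exact: p.
Qed.

Lemma is_derive_U {R : realType} (x : R) :
  is_derive x 1 (@U R) ((1 - U x ^+ 2) / Num.sqrt 2).
Proof.
have d : is_derive x 1 (fun y : R => y / Num.sqrt 2) (Num.sqrt 2)^-1.
  have := @is_deriveM R R id (fun=> (Num.sqrt 2)^-1) x 1 1 0 _ _.
  by rewrite /= scaler0 add0r /GRing.scale /= mulr1; apply.
exact: (@is_derive1_comp R (@tanh R) (fun y => y / Num.sqrt 2) x _ _ (is_derive_tanh _) d).
Qed.

Lemma continuous_U {R : realType} : continuous (@U R).
Proof.
move=> x; apply: differentiable_continuous; apply/derivable1_diffP.
by case: (is_derive_U x).
Qed.

Lemma derive1_U {R : realType} (x : R) :
  derive1 (@U R) x = (1 - U x ^+ 2) / Num.sqrt 2.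
Proof. by rewrite derive1E; have d := is_derive_U x; rewrite derive_val. Qed.

Lemma continuous_sqr {R : realType} (h : R -> R) :
  continuous h -> continuous (fun x => h x ^+ 2).
Proof.
move=> ch x; rewrite (_ : (fun x => _) = h \* h); first by apply: cvgM; exact: ch.
by apply/funext => y; rewrite expr2.
Qed.

Lemma continuous_fpU {R : realType} : continuous (fun x : R => fp (U x)).
Proof.
move=> x; apply: cvgB; last exact: cvg_cst.
apply: cvgM; first exact: cvg_cst.
exact: (continuous_sqr _ continuous_U).
Qed.

Lemma continuous_derive1_U {R : realType} : continuous (derive1 (@U R)).
Proof.
rewrite (_ : derive1 _ = fun x => (1 - U x ^+ 2) / Num.sqrt 2); last first.
  by apply/funext => x; exact: derive1_U.
move=> x; apply: cvgM; last exact: cvg_cst.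
apply: cvgB; first exact: cvg_cst.
exact: (continuous_sqr _ continuous_U).
Qed.

Lemma fpUE {R : realType} (x : R) : fp (U x) = 2 - 3 * (1 - U x ^+ 2).
Proof. by rewrite /fp; ring. Qed.

(** * Consequences of the hypothesis on [lambda0] *)

Lemma lambda0_compact {R : realType} (lambda0 a b : R) (F DF : R -> R) :
  lambda0_prop lambda0 ->
  a <= 0 -> 0 <= b -> L2_on `[a, b] F -> L2_on `[a, b] DF ->
  (forall x, a <= x <= b -> F x = \int[mu]_(t in `[a, x]) DF t) -> F b = 0 ->
  F 0 = 0 \/ \int[mu]_(x in `[a, b]) (F x * derive1 (@U R) x) = 0 ->
  \int[mu]_(x in `[a, b]) (- (DF x) ^+ 2 - fp (U x) * (F x) ^+ 2)
    <= - lambda0 * \int[mu]_(x in `[a, b]) (F x ^+ 2).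
Proof.
move=> lam a0 b0 LF LDF FE Fb orth.
have iDF : mu.-integrable `[a, b] (EFin \o DF).
  have L1 : L2_on `[a, b] (fun=> 1 : R).
    by apply: bounded_measurable_L2 => //; [exact: itv_lty|exact: bounded_measurable_cst].
  apply: eq_integrable (L2_integrableM _ _ _ _ LDF L1) => // x _.
  by rewrite /= mulr1.
have H := H1_line_restrict _ _ _ _ a0 b0 LF LDF iDF FE Fb.
rewrite [leLHS]Rintegral_mkcond [X in _ <= _ * X]Rintegral_mkcond.
apply: le_trans (le_trans (lam _ _ H _) _).
- rewrite le_eqVlt; apply/orP; left; apply/eqP; apply: eq_Rintegral => x _.
  by rewrite !patchE; case: ifP => _; rewrite ?expr0n /= ?mulr0 ?subr0 ?oppr0.
- case: orth => [F0|orth]; [left|right].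
    by rewrite patchE; case: ifP.
  rewrite -[RHS]orth [RHS]Rintegral_mkcond; apply: eq_Rintegral => x _.
  by rewrite !patchE; case: ifP => _; rewrite ?mul0r.
- rewrite le_eqVlt; apply/orP; left; apply/eqP; congr (_ * _); apply: eq_Rintegral => x _.
  by rewrite !patchE; case: ifP => _; rewrite ?expr0n.
Qed.

Lemma lambda0_le4 {R : realType} (lambda0 : R) : lambda0_prop lambda0 -> lambda0 <= 4.
Proof.
move=> lam.
(* For x (l - x) on [0, l] the ratio of the integrals of F'^2 and F^2 is 10 / l^2. As f'(U) <= 2,
   this gives lambda0 <= 2 + 10 / l^2, and l = 3 is the first integer for which this is at most
   4. *)
pose F : R -> R := fun x => 3 * x - x ^+ 2; pose DF : R -> R := fun x => 3 - 2 * x.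
have dF (x : R) : is_derive x (1 : R) F (DF x).
  rewrite /F; apply: is_derive_eq; rewrite /DF /GRing.scale /=; ring.
have cDF : continuous DF.
  by move=> x; apply: cvgB; [exact: cvg_cst|apply: cvgM; [exact: cvg_cst|exact: cvg_id]].
have cF : continuous F.
  by move=> x; apply: differentiable_continuous; apply/derivable1_diffP; case: (dF x).
have bF := bounded_measurable_continuous 0 3 _ cF.
have bDF := bounded_measurable_continuous 0 3 _ cDF.
have m3 : measurable (`[0, 3]%classic : set (measurableTypeR R)) by exact: measurable_itv.
have LF := bounded_measurable_L2 _ _ m3 (itv_lty _ _) bF.
have LDF := bounded_measurable_L2 _ _ m3 (itv_lty _ _) bDF.
have FE x : 0 <= x <= 3 -> F x = \int[mu]_(t in `[0, x]) DF t.
  by move=> /andP[x0 _]; rewrite (Rintegral_FTC F DF)// /F; ring.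
have F3 : F 3 = 0 by rewrite /F; ring.
have F0 : F 0 = 0 by rewrite /F; ring.
have := lambda0_compact _ _ _ _ _ lam (lexx _) (ler0n _ _) LF LDF FE F3 (or_introl F0).
set I := \int[mu]_(x in _) _; set J := \int[mu]_(x in _) _ => IJ.
have dF2 (x : R) : is_derive x (1 : R) (fun y : R => 3 * y ^+ 3 - 3 / 2 * y ^+ 4 + y ^+ 5 / 5) (F x ^+ 2).
  by apply: is_derive_eq; rewrite /F /GRing.scale /=; field.
have dDF2 (x : R) : is_derive x (1 : R) (fun y : R => 9 * y - 6 * y ^+ 2 + 4 / 3 * y ^+ 3) (DF x ^+ 2).
  by apply: is_derive_eq; rewrite /DF /GRing.scale /=; field.
have IF : J = 81 / 10.
  by rewrite /J (Rintegral_FTC _ _ _ _ (ler0n _ _) dF2 (continuous_sqr _ cF)); field.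
have IDF : \int[mu]_(x in `[0, 3]) (DF x ^+ 2) = 9.
  by rewrite (Rintegral_FTC _ _ _ _ (ler0n _ _) dDF2 (continuous_sqr _ cDF)); field.
have bU : bounded_measurable (`[0, 3]) (fun x : R => fp (U x)).
  by apply: bounded_measurable_continuous; exact: continuous_fpU.
have iF := L2_integrable_sqr _ _ m3 LF.
have iDF := L2_integrable_sqr _ _ m3 LDF.
have iUF : mu.-integrable `[0, 3] (EFin \o (fun x => fp (U x) * F x ^+ 2)).
  exact: integrable_bounded_measurableM.
have IE : I = -1 * \int[mu]_(x in `[0, 3]) (DF x ^+ 2) +
    (-1 * \int[mu]_(x in `[0, 3]) (fp (U x) * F x ^+ 2) + 0).
  transitivity (\int[mu]_(x in `[0, 3]) lincomb [:: (-1, fun x => DF x ^+ 2);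
    (-1, fun x => fp (U x) * F x ^+ 2)] x); last by rewrite Rintegral_lincomb.
  by apply: eq_Rintegral => x _; rewrite /lincomb /=; ring.
have := @le_Rintegral_lincomb R `[0, 3] (fun x => fp (U x) * F x ^+ 2)
  [:: (2, fun x => F x ^+ 2)] m3 iUF (conj iF Logic.I).
move: IJ; rewrite IE IDF /= => IJ bnd.
have {}bnd := bnd _; rewrite -/J in bnd.
suff ub x : fp (U x) * F x ^+ 2 <= lincomb [:: (2, fun x => F x ^+ 2)] x.
  have {}bnd := bnd (fun x _ => ub x); move: IJ bnd; rewrite IF; lra.
rewrite /lincomb /= addr0 ler_wpM2r ?sqr_ge0// fpUE.
by have := one_sub_U2_ge0 x; lra.
Qed.

(** * Coercivity around one layer *)

(** A parabola suffices: it vanishes exactly at -L and L, its slope is at most 2 / L in between, and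
    its defect is exactly y^2 / L^2, which the decay of the profile can absorb. *)
Definition cutoff {R : realType} (L y : R) : R := 1 - (y / L) ^+ 2.
Definition dcutoff {R : realType} (L y : R) : R := - (2 * y / L ^+ 2).

Lemma is_derive_cutoff {R : realType} (L y : R) :
  is_derive y (1 : R) (cutoff L) (dcutoff L y).
Proof.
rewrite /cutoff; apply: is_derive_eq; rewrite /dcutoff /GRing.scale /=.
by rewrite -exprVn; ring.
Qed.

Lemma continuous_dcutoff {R : realType} (L : R) : continuous (dcutoff L).
Proof.
move=> y; apply: cvgN; apply: cvgM; last exact: cvg_cst.
by apply: cvgM; [exact: cvg_cst|exact: cvg_id].
Qed.

Lemma continuous_cutoff {R : realType} (L : R) : continuous (cutoff L).
Proof.
move=> y; apply: differentiable_continuous; apply/derivable1_diffP.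
by case: (is_derive_cutoff L y).
Qed.

Lemma cutoff_itv {R : realType} (L y : R) : 0 < L -> - L <= y <= L -> 0 <= cutoff L y <= 1.
Proof.
move=> L0 /andP[Ly yL]; rewrite /cutoff.
have := sqr_ge0 (y / L).
have : - 1 <= y / L by rewrite ler_pdivlMr// mulN1r.
have : y / L <= 1 by rewrite ler_pdivrMr// mul1r.
by move=> ? ? ?; apply/andP; split; nra.
Qed.

Lemma dcutoff_sqr {R : realType} (L y : R) : 0 < L -> - L <= y <= L ->
  dcutoff L y ^+ 2 <= 4 / L ^+ 2.
Proof.
move=> L0 /andP[Ly yL].
have -> : dcutoff L y ^+ 2 = 4 / L ^+ 2 * (y / L) ^+ 2 by rewrite /dcutoff; field; rewrite gt_eqF.
rewrite ler_piMr ?divr_ge0 ?sqr_ge0//.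
have : - 1 <= y / L by rewrite ler_pdivlMr// mulN1r.
have : y / L <= 1 by rewrite ler_pdivrMr// mul1r.
nra.
Qed.

Lemma bounded_measurable_eq {R : realType} (D : set R) (f g : R -> R) :
  {in D, f =1 g} -> bounded_measurable D f -> bounded_measurable D g.
Proof.
move=> fg [mf [M fM]]; split; first exact: eq_measurable_fun mf.
by exists M => x Dx; rewrite -fg ?inE//; exact: fM.
Qed.

Lemma L2_integrable {R : realType} (a b : R) (f : R -> R) :
  L2_on `[a, b] f -> mu.-integrable `[a, b] (EFin \o f).
Proof.
move=> Lf.
have L1 : L2_on `[a, b] (fun=> 1 : R).
  by apply: bounded_measurable_L2 => //; [exact: itv_lty|exact: bounded_measurable_cst].
apply: eq_integrable (L2_integrableM _ _ _ (measurable_itv _) Lf L1) => // x _.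
by rewrite /= mulr1.
Qed.

(** A primitive is continuous within the interval, hence bounded there. So [v] can serve as a
    multiplier, and its derivative is the only factor that is merely square-integrable. *)
Lemma bounded_measurable_primitive {R : realType} (a b : R) (v g : R -> R) :
  a <= b -> L2_on `[a, b] g ->
  (forall x, a <= x <= b -> v x = v a + \int[mu]_(t in `[a, x]) g t) ->
  bounded_measurable `[a, b] v.
Proof.
move=> ab Lg vE.
apply: (@bounded_measurable_eq _ _ (fun x => v a + \int[mu]_(t in `[a, x]) g t)).
  by move=> x; rewrite inE /= in_itv /= => /vE.
apply: bounded_measurableD; first exact: bounded_measurable_cst.
apply: bounded_measurable_within; apply: parameterized_integral_continuous => //.
exact: L2_integrable.
Qed.

Lemma ge0_le_Rintegral_subset {R : realType} (A B : set (measurableTypeR R)) (f : R -> R) :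
  measurable A -> measurable B -> A `<=` B -> mu.-integrable B (EFin \o f) ->
  (forall x, B x -> 0 <= f x) ->
  \int[mu]_(x in A) f x <= \int[mu]_(x in B) f x.
Proof.
move=> mA mB AB fi f0; rewrite /Rintegral fine_le//.
- by apply: (@integrable_fin_num _ _ _ mu A mA (EFin \o f)); exact: integrableS fi.
- exact: (@integrable_fin_num _ _ _ mu B mB (EFin \o f)).
- by apply: ge0_subset_integral => //; exact: measurable_int fi.
Qed.

(* Here [a] is the constant subtracted from [V], [q] and [r] stand for [chi V'] and
   [chi' (V - a)], and [p] for [f'(U)]; the right-hand side is written in the shape
   that [le_Rintegral_lincomb] produces. *)
Lemma localization_pointwise {R : realType} (lam d chi a L p q r V : R) :
  0 < lam -> lam <= 4 -> d = lam / 18 -> 0 <= chi <= 1 -> 1 <= L ->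
  -1 <= p <= 2 -> r ^+ 2 <= 4 / L ^+ 2 * (V - a) ^+ 2 ->
  (1 + d) * (lam / 2) * (chi * V) ^+ 2 <=
  (1 + d) * q ^+ 2 + ((1 + d) * (p * (chi * V) ^+ 2) +
  (1 * (- (q + r) ^+ 2 - p * (chi * (V - a)) ^+ 2) +
  (lam * (chi * (V - a)) ^+ 2 + (8 * (1 + d^-1) / L ^+ 2 * V ^+ 2 + (14 * (1 + d^-1) * a ^+ 2 * 1 + 0))))).
Proof.
move=> lam0 lam4 dE /andP[chi0 chi1] L1 /andP[p1 p2] hr.
have d0 : 0 < d by rewrite dE divr_gt0.
have di0 : 0 < d^-1 by rewrite invr_gt0.
have dd : d * d^-1 = 1 by rewrite mulfV// gt_eqF.
have h1 : (q + r) ^+ 2 <= (1 + d) * q ^+ 2 + (1 + d^-1) * r ^+ 2.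
  rewrite -subr_ge0 (_ : _ - _ = d^-1 * (d * q - r) ^+ 2); last by field; rewrite gt_eqF.
  by rewrite mulr_ge0 ?sqr_ge0// ltW.
set v := chi * V; set c := chi * a.
have -> : chi * (V - a) = v - c by rewrite /v /c; ring.
have h2 : `|2 * c * v| <= d * v ^+ 2 + d^-1 * c ^+ 2.
  rewrite ler_norml; apply/andP; split; rewrite -subr_ge0.
    rewrite (_ : _ - _ = d^-1 * (d * v + c) ^+ 2); last by field; rewrite gt_eqF.
    by rewrite mulr_ge0 ?sqr_ge0// ltW.
  rewrite (_ : _ - _ = d^-1 * (d * v - c) ^+ 2); last by field; rewrite gt_eqF.
  by rewrite mulr_ge0 ?sqr_ge0// ltW.
(* The factor 5 bounds |lam - p|, since 0 < lam <= 4 and -1 <= p <= 2. *)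
have h3 : (lam - p) * (2 * c * v) <= 5 * (d * v ^+ 2 + d^-1 * c ^+ 2).
  move: h2; set X := 2 * c * v; set Y := d * _ + _; rewrite ler_norml => /andP[]; nra.
have h4 : c ^+ 2 <= a ^+ 2 by rewrite /c exprMn ler_piMl ?sqr_ge0// expr_le1.
have h5 : (V - a) ^+ 2 <= 2 * V ^+ 2 + 2 * a ^+ 2 by have := sqr_ge0 (V + a); nra.
have iL0 : 0 <= 4 / L ^+ 2 by rewrite divr_ge0// sqr_ge0.
have iL1 : 4 / L ^+ 2 <= 4 by rewrite ler_pdivrMr ?exprn_gt0//; nra.
have h6 : (1 + d^-1) * r ^+ 2 <= 8 * (1 + d^-1) / L ^+ 2 * V ^+ 2 + 8 * (1 + d^-1) * a ^+ 2.
  have -> : 8 * (1 + d^-1) / L ^+ 2 * V ^+ 2 = (1 + d^-1) * (4 / L ^+ 2 * (2 * V ^+ 2)).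
    by field; rewrite !gt_eqF//; lra.
  have -> : 8 * (1 + d^-1) * a ^+ 2 = (1 + d^-1) * (8 * a ^+ 2) by ring.
  rewrite -mulrDr; apply: ler_wpM2l; first by lra.
  apply: le_trans hr _; apply: le_trans (ler_wpM2l iL0 h5) _.
  have := sqr_ge0 a; nra.
have v2 := sqr_ge0 v; have c2 := sqr_ge0 c.
(* This fixes [d]: from lam <= 4 one gets (1 + d) lam / 2 <= lam / 2 + 2d, and 2d + 7d = lam / 2. *)
have h7 : (1 + d) * (lam / 2) * v ^+ 2 <= (lam - 7 * d) * v ^+ 2.
  by rewrite ler_wpM2r// dE; nra.
have h8 : d * (p * v ^+ 2) >= - d * v ^+ 2.
  rewrite -subr_ge0 (_ : _ - _ = d * (v ^+ 2 * (p + 1))); last by ring.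
  by apply: mulr_ge0; [exact: ltW|apply: mulr_ge0 => //; lra].
have h9 : (lam - p) * c ^+ 2 >= - 2 * c ^+ 2 by nra.
have h10 : d^-1 * c ^+ 2 <= d^-1 * a ^+ 2 by rewrite ler_wpM2l// ltW.
have h11 := mulr_ge0 (ltW di0) (sqr_ge0 a).
have h12 := sqr_ge0 a.
have dv := mulr_ge0 (ltW d0) v2.
nra.
Qed.

Lemma Rintegral_cst_itv {R : realType} (a b c : R) :
  a <= b -> \int[mu]_(x in `[a, b]) c = c * (b - a).
Proof.
move=> ab; have dc (x : R) : is_derive x (1 : R) (fun y : R => c * y) c.
  by apply: is_derive_eq; rewrite /GRing.scale /=; ring.
by rewrite (Rintegral_FTC _ _ _ _ ab dc (fun x => cvg_cst _)); ring.
Qed.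

(** This mass is the denominator of the constant that restores orthogonality, so it needs a bound
    uniform in [L]. The interval [-1/2, 1/2] provides it: there the cut-off is at least 3/4 and U'
    is bounded below. *)
Lemma cutoff_mass {R : realType} : exists2 m : R, 0 < m & forall L : R, 1 <= L ->
  m <= \int[mu]_(y in `[- L, L]) (cutoff L y * derive1 (@U R) y).
Proof.
have [s s0 sU] := @one_sub_U2_lower R.
have r2 : 0 < Num.sqrt 2 :> R by rewrite sqrtr_gt0.
exists (3 / 4 * (s / Num.sqrt 2)); first by rewrite mulr_gt0// ?divr_gt0.
move=> L L1.
have bm a b : bounded_measurable `[a, b] (fun y => cutoff L y * derive1 (@U R) y).
  apply: bounded_measurableM; apply: bounded_measurable_continuous.
    exact: continuous_cutoff.
  exact: continuous_derive1_U.
have im a b : mu.-integrable `[a, b] (EFin \o (fun y => cutoff L y * derive1 (@U R) y)).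
  apply: L2_integrable; apply: bounded_measurable_L2 => //; first exact: itv_lty.
apply: (@le_trans _ _ (\int[mu]_(y in `[- (1/2), 1/2]) (cutoff L y * derive1 (@U R) y))); last first.
  apply: ge0_le_Rintegral_subset => //.
    by apply: subset_itv; rewrite bnd_simp; lra.
  move=> y; rewrite /= in_itv /= => yL; rewrite mulr_ge0//.
    by have /andP[] := cutoff_itv _ _ (lt_le_trans ltr01 L1) yL.
  by rewrite derive1_U divr_ge0 ?one_sub_U2_ge0// ltW.
have -> : 3 / 4 * (s / Num.sqrt 2) = \int[mu]_(y in `[- (1 / 2), 1 / 2]) (3 / 4 * (s / Num.sqrt 2)).
  by rewrite Rintegral_cst_itv; [field; rewrite gt_eqF|lra].
apply: le_Rintegral => //.
  apply: L2_integrable; apply: bounded_measurable_L2 => //; first exact: itv_lty.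
  exact: bounded_measurable_cst.
move=> y; rewrite /= in_itv /= => /andP[y1 y2].
apply: ler_pM; [by rewrite divr_ge0|by rewrite divr_ge0 ?(ltW s0) ?(ltW r2)| |].
- rewrite /cutoff; have : (y / L) ^+ 2 <= 1 / 4; last by lra.
  rewrite expr_div_n ler_pdivrMr ?exprn_gt0; nra.
- rewrite derive1_U ler_pM2r ?invr_gt0//; apply: sU.
  by rewrite ler_norml; apply/andP; split; lra.
Qed.

(** There is no boundary term because [cutoff L (- L) = 0]: the product rule treats the integral
    part of [V], and for the constant [V (- L)] the cut-off is itself the primitive of [dcutoff L]
    from -L. The result has the shape required by [lambda0_compact]. *)
Lemma localized_primitive {R : realType} (L y : R) (V G : R -> R) :
  0 < L -> L2_on `[- L, L] G ->
  (forall x, - L <= x <= L -> V x = V (- L) + \int[mu]_(t in `[- L, x]) G t) ->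
  - L <= y <= L ->
  cutoff L y * V y = \int[mu]_(t in `[- L, y]) (cutoff L t * G t + dcutoff L t * V t).
Proof.
move=> L0 LG VE /andP[Ly yL].
have LGy : L2_on `[- L, y] G.
  by apply: L2_onS LG => //; apply: subset_itv; rewrite bnd_simp.
have iG := L2_integrable _ _ _ LGy.
rewrite [V y]VE ?Ly ?yL// mulrDr.
rewrite (Rintegral_product_rule _ _ _ _ _ Ly (is_derive_cutoff L) (@continuous_dcutoff _ L) iG).
have -> : cutoff L y * V (- L) = \int[mu]_(t in `[- L, y]) (dcutoff L t * V (- L)).
  rewrite RintegralZr//; last first.
    apply: L2_integrable; apply: bounded_measurable_L2 => //; first exact: itv_lty.
    by apply: bounded_measurable_continuous; exact: continuous_dcutoff.
  rewrite (Rintegral_FTC _ _ _ _ Ly (is_derive_cutoff L) (@continuous_dcutoff _ L)).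
  by congr (_ * _); rewrite /cutoff; field; rewrite gt_eqF.
have bP : bounded_measurable `[- L, y] (fun t => \int[mu]_(s in `[- L, t]) G s).
  apply: bounded_measurable_within; apply: parameterized_integral_continuous => //.
have bd := bounded_measurable_continuous (- L) y _ (@continuous_dcutoff _ L).
have bc := bounded_measurable_continuous (- L) y _ (@continuous_cutoff _ L).
have my : measurable (`[- L, y]%classic : set (measurableTypeR R)) by exact: measurable_itv.
have cst c := @bounded_measurable_cst R `[- L, y] c.
have L2b h := bounded_measurable_L2 `[- L, y] h my (itv_lty _ _).
rewrite -RintegralD//.
- apply: eq_Rintegral => t; rewrite inE /= in_itv /= => /andP[t1 t2].
  by rewrite [V t]VE ?t1 ?(le_trans t2 yL)//; ring.
- by apply: L2_integrable; apply: L2b; exact: bounded_measurableM.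
- apply: L2_integrable; apply: L2_onD => //; first exact: L2_onM.
  by apply: L2b; exact: bounded_measurableM.
Qed.

Lemma localized_coercivity {R : realType} (lam : R) : 0 < lam -> lambda0_prop lam ->
  exists2 C : R, 0 < C & forall (L : R) (V G : R -> R), 1 <= L ->
  L2_on `[- L, L] G ->
  (forall y, - L <= y <= L -> V y = V (- L) + \int[mu]_(t in `[- L, y]) G t) ->
  lam / 2 * \int[mu]_(y in `[- L, L]) ((cutoff L y * V y) ^+ 2)
    - C * ((\int[mu]_(y in `[- L, L]) (V y ^+ 2)) / L ^+ 2
      + L * (\int[mu]_(y in `[- L, L]) (cutoff L y * V y * derive1 (@U R) y)) ^+ 2)
  <= \int[mu]_(y in `[- L, L]) ((cutoff L y * G y) ^+ 2)
     + \int[mu]_(y in `[- L, L]) (fp (U y) * (cutoff L y * V y) ^+ 2).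
Proof.
move=> lam0 lamP; have lam4 := lambda0_le4 _ lamP.
have [m m0 mP] := @cutoff_mass R.
pose d : R := lam / 18; pose k := 1 + d^-1.
have d0 : 0 < d by rewrite /d divr_gt0.
have k0 : 0 < k by rewrite /k addr_gt0 ?invr_gt0.
(* The 8 comes from the derivative of the cut-off acting on [V]. The 28 is the coefficient 14 of a^2
   in the pointwise inequality times the 2 of the length 2L, and a^2 <= B^2 / m^2. *)
exists (k * (28 / m ^+ 2 + 8)).
  by rewrite mulr_gt0// addr_gt0// divr_gt0// exprn_gt0.
move=> L V G L1 LG VE.
have L0 : 0 < L by apply: lt_le_trans L1.
have LL : - L <= L by lra.
set D := `[- L, L]%classic.
have mD : measurable (D : set (measurableTypeR R)) by exact: measurable_itv.
have bV : bounded_measurable D V by exact: bounded_measurable_primitive LG VE.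
have bc : bounded_measurable D (cutoff L) by apply: bounded_measurable_continuous; exact: continuous_cutoff.
have bd : bounded_measurable D (dcutoff L) by apply: bounded_measurable_continuous; exact: continuous_dcutoff.
have bU : bounded_measurable D (derive1 (@U R)) by apply: bounded_measurable_continuous; exact: continuous_derive1_U.
have bp : bounded_measurable D (fun y => fp (U y)) by apply: bounded_measurable_continuous; exact: continuous_fpU.
have bcst c : bounded_measurable D (fun=> c) by exact: bounded_measurable_cst.
have L2b h : bounded_measurable D h -> L2_on D h by apply: bounded_measurable_L2 => //; exact: itv_lty.
have ib h : bounded_measurable D h -> mu.-integrable D (EFin \o h).
  by move=> bh; apply: L2_integrable; exact: L2b.
set M := \int[mu]_(y in D) (cutoff L y * derive1 (@U R) y).
set B := \int[mu]_(y in D) (cutoff L y * V y * derive1 (@U R) y).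
have mM : m <= M by exact: mP.
have M0 : 0 < M by exact: lt_le_trans mM.
pose a := B / M.
pose W y := V y - a.
have bW : bounded_measurable D W by apply: bounded_measurableD => //.
have WE y : - L <= y <= L -> W y = W (- L) + \int[mu]_(t in `[- L, y]) G t.
  by move=> yL; rewrite /W VE//; ring.
have bcW : bounded_measurable D (fun y => cutoff L y * W y) by exact: bounded_measurableM.
have bcV : bounded_measurable D (fun y => cutoff L y * V y) by exact: bounded_measurableM.
have LDF : L2_on D (fun y => cutoff L y * G y + dcutoff L y * W y).
  by apply: L2_onD => //; [exact: L2_onM|apply: L2b; exact: bounded_measurableM].
have LcG : L2_on D (fun y => cutoff L y * G y) by exact: L2_onM.
have orth : \int[mu]_(y in D) (cutoff L y * W y * derive1 (@U R) y) = 0.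
  transitivity (\int[mu]_(y in D) lincomb [:: (1, fun y => cutoff L y * V y * derive1 (@U R) y);
      (- a, fun y => cutoff L y * derive1 (@U R) y)] y).
    by apply: eq_Rintegral => y _; rewrite /lincomb /W /=; ring.
  rewrite Rintegral_lincomb//=; last first.
    by split; [|split=> //]; apply: ib; exact: bounded_measurableM.
  by rewrite -/B -/M /a; field; rewrite gt_eqF.
have N0 : - L <= 0 by lra.
have cL0 : cutoff L L * W L = 0 by rewrite /cutoff divff ?gt_eqF// expr1n subrr mul0r.
have key := lambda0_compact _ (- L) L (fun y => cutoff L y * W y) _ lamP N0 (ltW L0)
  (L2b _ bcW) LDF
  (fun y yL => localized_primitive _ _ _ _ L0 LG WE yL) cL0 (or_intror orth).
have iE : mu.-integrable D (EFin \o (fun y => - (cutoff L y * G y + dcutoff L y * W y) ^+ 2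
    - fp (U y) * (cutoff L y * W y) ^+ 2)).
  have := @integrable_lincomb R D [:: (-1, fun y => (cutoff L y * G y + dcutoff L y * W y) ^+ 2);
    (-1, fun y => fp (U y) * (cutoff L y * W y) ^+ 2)] mD.
  move=> /(_ _); rewrite (_ : lincomb _ = fun y => - (cutoff L y * G y + dcutoff L y * W y) ^+ 2
    - fp (U y) * (cutoff L y * W y) ^+ 2); last by apply/funext => y; rewrite /lincomb /=; ring.
  apply; split; first exact: L2_integrable_sqr.
  split=> //; apply: ib; apply: bounded_measurableM => //; exact: bounded_measurableX.
have := @le_Rintegral_lincomb R D (fun y => (1 + d) * (lam / 2) * (cutoff L y * V y) ^+ 2)
  [:: (1 + d, fun y => (cutoff L y * G y) ^+ 2); (1 + d, fun y => fp (U y) * (cutoff L y * V y) ^+ 2);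
      (1, fun y => - (cutoff L y * G y + dcutoff L y * W y) ^+ 2 - fp (U y) * (cutoff L y * W y) ^+ 2);
      (lam, fun y => (cutoff L y * W y) ^+ 2); (8 * k / L ^+ 2, fun y => V y ^+ 2);
      (14 * k * a ^+ 2, fun=> 1)] mD.
rewrite [\int[mu]_(x in D) ((1 + d) * _ * _)]RintegralZl//; last first.
  by apply: ib; exact: bounded_measurableX.
move=> main.
set VV := \int[mu]_(y in D) (V y ^+ 2).
set vv := \int[mu]_(y in D) ((cutoff L y * V y) ^+ 2).
set X1 := \int[mu]_(y in D) ((cutoff L y * G y) ^+ 2).
set X2 := \int[mu]_(y in D) (fp (U y) * (cutoff L y * V y) ^+ 2).
have VV0 : 0 <= VV by apply: Rintegral_ge0 => y _; exact: sqr_ge0.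
have one : \int[mu]_(x in D) (fun=> 1) x = 2 * L by rewrite /= Rintegral_cst_itv//; ring.
have a2 : a ^+ 2 <= B ^+ 2 / m ^+ 2.
  rewrite /a expr_div_n ler_wpM2l ?sqr_ge0// lef_pV2 ?posrE ?exprn_gt0//.
  by rewrite lerXn2r// ?nnegrE ltW.
have i1 : mu.-integrable D (EFin \o (fun y => (1 + d) * (lam / 2) * (cutoff L y * V y) ^+ 2)).
  by apply: ib; apply: bounded_measurableM => //; exact: bounded_measurableX.
have i2 : all_integrable D [:: (1 + d, fun y => (cutoff L y * G y) ^+ 2); (1 + d, fun y => fp (U y) * (cutoff L y * V y) ^+ 2);
      (1, fun y => - (cutoff L y * G y + dcutoff L y * W y) ^+ 2 - fp (U y) * (cutoff L y * W y) ^+ 2);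
      (lam, fun y => (cutoff L y * W y) ^+ 2); (8 * k / L ^+ 2, fun y => V y ^+ 2);
      (14 * k * a ^+ 2, fun=> 1)].
  split; first exact: L2_integrable_sqr.
  split; first by apply: ib; apply: bounded_measurableM => //; exact: bounded_measurableX.
  split=> //; split; first by apply: ib; exact: bounded_measurableX.
  split; first by apply: ib; exact: bounded_measurableX.
  by split; [apply: ib; exact: bcst|].
have i3 y : D y -> (1 + d) * (lam / 2) * (cutoff L y * V y) ^+ 2 <=
   lincomb [:: (1 + d, fun y => (cutoff L y * G y) ^+ 2); (1 + d, fun y => fp (U y) * (cutoff L y * V y) ^+ 2);
      (1, fun y => - (cutoff L y * G y + dcutoff L y * W y) ^+ 2 - fp (U y) * (cutoff L y * W y) ^+ 2);
      (lam, fun y => (cutoff L y * W y) ^+ 2); (8 * k / L ^+ 2, fun y => V y ^+ 2);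
      (14 * k * a ^+ 2, fun=> 1)] y.
  rewrite /D /= in_itv /= => yL; apply: localization_pointwise => //.
  - exact: cutoff_itv.
  - by rewrite fpUE; have := one_sub_U2_ge0 y; have := sqr_ge0 (U y); lra.
  - by rewrite exprMn ler_wpM2r ?sqr_ge0//; exact: dcutoff_sqr.
have bound : (1 + d) * (lam / 2 * vv - X1 - X2) <= 8 * k * (VV / L ^+ 2) + 28 * k * (L * a ^+ 2).
  move: main => /(_ _ _ _) main.
  have {}main := main i1 i2 i3; move: main; rewrite /= one -/vv -/X1 -/X2 -/VV.
  rewrite (_ : 8 * k / L ^+ 2 * VV = 8 * k * (VV / L ^+ 2)); last by ring.
  rewrite (_ : 14 * k * a ^+ 2 * (2 * L) = 28 * k * (L * a ^+ 2)); last by ring.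
  move: key; set E := \int[mu]_(y in D) (_ - _); set WW := \int[mu]_(y in D) _.
  by move=> key main; lra.
have p1 : 0 <= VV / L ^+ 2 by rewrite divr_ge0// sqr_ge0.
have p2 : L * a ^+ 2 <= L * (B ^+ 2 / m ^+ 2) by rewrite ler_wpM2l// ltW.
have p3 : 0 <= L * B ^+ 2 by rewrite mulr_ge0 ?sqr_ge0// ltW.
have p4 : 0 <= L * a ^+ 2 by rewrite mulr_ge0 ?sqr_ge0// ltW.
have p5 : 0 <= (m ^+ 2)^-1 by rewrite invr_ge0 sqr_ge0.
(* Removing the factor 1 + d: a nonnegative quantity is at most its multiple by 1 + d, and a
   negative one lies below the nonnegative right-hand side. *)
have p6 : lam / 2 * vv - X1 - X2 <= 8 * k * (VV / L ^+ 2) + 28 * k * (L * a ^+ 2).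
  have := mulr_ge0 (ltW k0) p1; have := mulr_ge0 (ltW k0) p4.
  by have [x0|x0] := leP 0 (lam / 2 * vv - X1 - X2); nra.
suff : 8 * k * (VV / L ^+ 2) + 28 * k * (L * a ^+ 2) <= k * (28 / m ^+ 2 + 8) * (VV / L ^+ 2 + L * B ^+ 2) by lra.
rewrite -subr_ge0 (_ : _ - _ = k * (28 * ((m ^+ 2)^-1 * (VV / L ^+ 2)) + 8 * (L * B ^+ 2) + 28 * (L * (B ^+ 2 / m ^+ 2) - L * a ^+ 2))); last by ring.
by rewrite mulr_ge0 ?(ltW k0)//; have := mulr_ge0 p5 p1; lra.
Qed.

Lemma continuous_rescale {R : realType} (e p : R) (h : R -> R) :
  continuous h -> continuous (fun x : R => h ((x - p) / e)).
Proof.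
move=> ch x; apply: (@continuous_comp _ _ _ (fun x : R => (x - p) / e) h); last exact: ch.
apply: cvgM; last exact: cvg_cst.
by apply: cvgB; [exact: cvg_id|exact: cvg_cst].
Qed.

Lemma localized_coercivity_scaled {R : realType} (lam : R) : 0 < lam -> lambda0_prop lam ->
  exists2 C : R, 0 < C & forall (e p L : R) (v g : R -> R), 0 < e -> 1 <= L ->
  let D := `[p + e * (- L), p + e * L]%classic in
  L2_on D g ->
  (forall x, p + e * (- L) <= x <= p + e * L ->
    v x = v (p + e * (- L)) + \int[mu]_(t in `[p + e * (- L), x]) g t) ->
  lam / 2 * \int[mu]_(x in D) ((cutoff L ((x - p) / e) * v x) ^+ 2)
    - C * ((\int[mu]_(x in D) (v x ^+ 2)) / L ^+ 2
      + L / e * (\int[mu]_(x in D) (cutoff L ((x - p) / e) * v x * derive1 (@U R) ((x - p) / e))) ^+ 2)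
  <= e ^+ 2 * \int[mu]_(x in D) ((cutoff L ((x - p) / e) * g x) ^+ 2)
     + \int[mu]_(x in D) (fp (U ((x - p) / e)) * (cutoff L ((x - p) / e) * v x) ^+ 2).
Proof.
move=> lam0 lamP; have [C C0 H] := localized_coercivity _ lam0 lamP.
exists C => // e p L v g e0 L1 D Lg vE.
have L0 : 0 < L by apply: lt_le_trans L1.
have LL : p + e * (- L) <= p + e * L by rewrite lerD2l ler_pM2l//; lra.
have mD : measurable (D : set (measurableTypeR R)) by exact: measurable_itv.
have bv : bounded_measurable D v by exact: bounded_measurable_primitive Lg vE.
have bres h : continuous h -> bounded_measurable D (fun x => h ((x - p) / e)).
  by move=> ch; apply: bounded_measurable_continuous; exact: continuous_rescale.
have bc : bounded_measurable D (fun x => cutoff L ((x - p) / e)) by apply: bres; exact: continuous_cutoff.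
have bU := bres _ (@continuous_derive1_U R).
have bp := bres _ (@continuous_fpU R).
have ib (h : R -> R) : bounded_measurable D h -> mu.-integrable D (EFin \o h).
  move=> bh; apply: L2_integrable; apply: bounded_measurable_L2 => //; exact: itv_lty.
have yE (y : R) : (p + e * y - p) / e = y by field; rewrite gt_eqF.
(* Under x = p + e y every integral acquires 1 / e, and the gradient also e^2. The squared pairing
   with U' acquires 1 / e^2, so the factor L / e is left once the common 1 / e is cancelled. *)
pose V y := v (p + e * y); pose G y := e * g (p + e * y).
have LG : L2_on `[- L, L] G.
  by apply: L2_onM => //; [exact: bounded_measurable_cst|exact: L2_on_affine_itv].
have VE y : - L <= y <= L -> V y = V (- L) + \int[mu]_(t in `[- L, y]) G t.
  move=> /andP[Ly yL].
  have Lgy : L2_on `[p + e * (- L), p + e * y] g.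
    by apply: L2_onS Lg => //; apply: subset_itv; rewrite bnd_simp ?lerD2l ?ler_pM2l.
  rewrite /V vE ?lerD2l ?ler_pM2l ?Ly//; congr (_ + _).
  have Leg : L2_on `[p + e * (- L), p + e * y] (fun x => e * g x).
    by apply: L2_onM => //; exact: bounded_measurable_cst.
  rewrite (@Rintegral_affine_itv _ e p (- L) y (fun x => e * g x))//; last exact: L2_integrable.
  rewrite RintegralZl//; last exact: L2_integrable.
  by rewrite mulKf// gt_eqF.
have scale h : mu.-integrable D (EFin \o h) ->
    \int[mu]_(y in `[- L, L]) h (p + e * y) = e^-1 * \int[mu]_(x in D) h x.
  by move=> ih; exact: Rintegral_affine_itv.
have E1 : \int[mu]_(y in `[- L, L]) ((cutoff L y * V y) ^+ 2) =
    e^-1 * \int[mu]_(x in D) ((cutoff L ((x - p) / e) * v x) ^+ 2).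
  rewrite -scale; first by apply: eq_Rintegral => y _; rewrite yE.
  by apply: ib; apply: bounded_measurableX; exact: bounded_measurableM.
have E2 : \int[mu]_(y in `[- L, L]) (V y ^+ 2) = e^-1 * \int[mu]_(x in D) (v x ^+ 2).
  rewrite -scale; first by apply: eq_Rintegral => y _.
  by apply: ib; exact: bounded_measurableX.
have E3 : \int[mu]_(y in `[- L, L]) (cutoff L y * V y * derive1 (@U R) y) =
    e^-1 * \int[mu]_(x in D) (cutoff L ((x - p) / e) * v x * derive1 (@U R) ((x - p) / e)).
  rewrite -scale; first by apply: eq_Rintegral => y _; rewrite yE.
  by apply: ib; apply: bounded_measurableM => //; exact: bounded_measurableM.
have E4 : \int[mu]_(y in `[- L, L]) (fp (U y) * (cutoff L y * V y) ^+ 2) =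
    e^-1 * \int[mu]_(x in D) (fp (U ((x - p) / e)) * (cutoff L ((x - p) / e) * v x) ^+ 2).
  rewrite -scale; first by apply: eq_Rintegral => y _; rewrite yE.
  by apply: ib; apply: bounded_measurableM => //; apply: bounded_measurableX; exact: bounded_measurableM.
have ig : mu.-integrable D (EFin \o (fun x => (cutoff L ((x - p) / e) * g x) ^+ 2)).
  by apply: L2_integrable_sqr => //; exact: L2_onM.
have E5 : \int[mu]_(y in `[- L, L]) ((cutoff L y * G y) ^+ 2) =
    e^-1 * (e ^+ 2 * \int[mu]_(x in D) ((cutoff L ((x - p) / e) * g x) ^+ 2)).
  rewrite -RintegralZl// -scale.
    by apply: eq_Rintegral => y _; rewrite yE /G; ring.
  by apply: eq_integrable (integrableZl mD (e ^+ 2) ig).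
have := H L V G L1 LG VE; rewrite E1 E2 E3 E4 E5 -mulrDr.
set X := _ + \int[mu]_(x in D) _; set vv := \int[mu]_(x in D) ((_ * v x) ^+ 2).
set VV := \int[mu]_(x in D) (v x ^+ 2); set B := \int[mu]_(x in D) (_ * v x * _).
have ei : 0 < e^-1 by rewrite invr_gt0.
rewrite (_ : lam / 2 * (e^-1 * vv) - _ = e^-1 * (lam / 2 * vv - C * (VV / L ^+ 2 + L / e * B ^+ 2))).
  by rewrite ler_pM2l.
by field; rewrite !gt_eqF.
Qed.

Lemma Rintegral_sum {R : realType} (I : Type) (s : seq I) (D : set (measurableTypeR R))
    (F : I -> R -> R) :
  measurable D -> (forall i, mu.-integrable D (EFin \o F i)) ->
  mu.-integrable D (EFin \o (fun x => \sum_(i <- s) F i x)) /\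
  \int[mu]_(x in D) (\sum_(i <- s) F i x) = \sum_(i <- s) \int[mu]_(x in D) F i x.
Proof.
move=> mD iF; elim: s => [|i s [is1 IH]].
  rewrite (_ : (fun x => _) = fun=> 0); last by apply/funext => x; rewrite big_nil.
  by rewrite big_nil Rintegral_cst// mul0r; split => //; exact: integrable0.
rewrite (_ : (fun x => _) = fun x => F i x + \sum_(i <- s) F i x); last first.
  by apply/funext => x; rewrite big_cons.
rewrite RintegralD// big_cons IH; split=> //.
exact: eq_integrable (integrableD mD (iF i) is1).
Qed.

Lemma derive1_U_decay {R : realType} (y : R) :
  0 <= derive1 (@U R) y /\ y ^+ 4 * derive1 (@U R) y <= 24.
Proof.
have r1 : 1 <= Num.sqrt 2 :> R by rewrite -[leLHS]sqrtr1 ler_sqrt// ler1n.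
have S0 := one_sub_U2_ge0 y; have S4 := one_sub_U2_decay y.
rewrite derive1_U; split; first by rewrite divr_ge0.
rewrite mulrA ler_pdivrMr; last exact: lt_le_trans r1.
by apply: le_trans S4 _; rewrite ler_peMr.
Qed.

(** * Cut-offs on [0, 1] and almost orthogonality *)

Definition icutoff {R : realType} (L y : R) : R := if - L <= y <= L then cutoff L y else 0.

Lemma icutoff_itv {R : realType} (L y : R) : 0 < L ->
  [/\ 0 <= icutoff L y, icutoff L y <= 1 & 1 - icutoff L y <= y ^+ 2 / L ^+ 2].
Proof.
move=> L0; rewrite /icutoff; case: ifPn => yL.
  have /andP[-> ->] := cutoff_itv _ _ L0 yL; split=> //.
  by rewrite /cutoff expr_div_n; lra.
split=> //; rewrite subr0 ler_pdivlMr ?exprn_gt0// mul1r.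
by move: yL; rewrite negb_and -!ltNge => /orP[|] ?; nra.
Qed.

Lemma icutoff_rescale {R : realType} (e p L : R) : 0 < e ->
  (fun x => icutoff L ((x - p) / e)) =
  (fun x => cutoff L ((x - p) / e)) \_ `[p + e * (- L), p + e * L].
Proof.
move=> e0; apply/funext => x; rewrite patchE /icutoff.
have -> : (x \in `[p + e * (- L), p + e * L]%classic) = (- L <= (x - p) / e <= L).
  apply/idP/idP; rewrite inE /= in_itv /= ler_pdivlMr// ler_pdivrMr//;
    by move=> /andP[? ?]; apply/andP; split; nra.
by case: ifP.
Qed.

Lemma bounded_measurable_icutoff {R : realType} (e p L a b : R) : 0 < e -> 0 < L ->
  bounded_measurable `[a, b] (fun x => icutoff L ((x - p) / e)).
Proof.
move=> e0 L0; split; last first.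
  exists 1 => x _; have [c0 c1 _] := icutoff_itv L ((x - p) / e) L0.
  by rewrite ger0_norm.
rewrite icutoff_rescale//; apply: (@measurable_funS _ _ _ _ setT) => //.
apply/measurable_restrict => //; rewrite setTI.
have [] // := bounded_measurable_continuous (p + e * (- L)) (p + e * L) _
  (@continuous_rescale _ e p _ (@continuous_cutoff _ L)).
Qed.

(** [K] takes the value of the cut-off as an argument so that one statement covers the mass,
    gradient, potential and pairing integrals. *)
Lemma Rintegral_icutoff {R : realType} (e p L : R) (K : R -> R -> R) : 0 < e ->
  0 <= p + e * (- L) -> p + e * L <= 1 -> (forall x, K x 0 = 0) ->
  \int[mu]_(x in `[0, 1]) K x (icutoff L ((x - p) / e)) =
  \int[mu]_(x in `[p + e * (- L), p + e * L]) K x (cutoff L ((x - p) / e)).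
Proof.
move=> e0 p0 p1 K0; set D := `[p + e * (- L), p + e * L]%classic.
have -> : D = `[0, 1] `&` D.
  by apply/esym/setIidr; apply: subset_itv; rewrite bnd_simp.
rewrite Rintegral_mkcondr; apply: eq_Rintegral => x _.
have /(congr1 (fun f => f x)) /= -> := @icutoff_rescale R e p L e0.
by rewrite !patchE; case: ifP.
Qed.

(** With y = (x - p) / e, the factor (1 - chi)^2 <= y^4 / L^4 is absorbed by one of the two factors
    U' through y^4 U' <= 24. The other is integrated exactly: its primitive e U varies by at most
    2e, hence the factor [e]. *)
Lemma cutoff_defect {R : realType} (e p L : R) : 0 < e -> 0 < L ->
  \int[mu]_(x in `[0, 1]) (((1 - icutoff L ((x - p) / e)) * derive1 (@U R) ((x - p) / e)) ^+ 2)
  <= 48 * e / L ^+ 4.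
Proof.
move=> e0 L0.
have m01 : measurable (`[0, 1]%classic : set (measurableTypeR R)) by exact: measurable_itv.
have bc := bounded_measurable_icutoff e p L 0 1 e0 L0.
have cU := @continuous_rescale _ e p _ (@continuous_derive1_U R).
have bU := bounded_measurable_continuous 0 1 _ cU.
have ib (h : R -> R) : bounded_measurable `[0, 1] h -> mu.-integrable `[0, 1] (EFin \o h).
  move=> bh; apply: L2_integrable; apply: bounded_measurable_L2 => //; exact: itv_lty.
have b1 : bounded_measurable `[0, 1] (fun x => 1 - icutoff L ((x - p) / e)).
  by apply: bounded_measurableD; [exact: bounded_measurable_cst|exact: bounded_measurableN].
have dF (x : R) : is_derive x (1 : R) (fun x : R => e * U ((x - p) / e)) (derive1 (@U R) ((x - p) / e)).
  have d1 : is_derive x (1 : R) (fun x : R => (x - p) / e) e^-1.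
    by apply: is_derive_eq; rewrite /GRing.scale /=; ring.
  have d2 := @is_derive1_comp R (@U R) (fun x : R => (x - p) / e) x _ _ (is_derive_U _) d1.
  have d3 := @is_deriveZ R R R _ e x 1 _ d2.
  by apply: is_derive_eq d3 _; rewrite derive1_U /GRing.scale /=; field; rewrite !gt_eqF// sqrtr_gt0.
apply: (@le_trans _ _ (24 / L ^+ 4 * (e * U ((1 - p) / e) - e * U ((0 - p) / e)))); last first.
  rewrite (_ : 48 * e / L ^+ 4 = 24 / L ^+ 4 * (2 * e)); last by ring.
  apply: ler_wpM2l; first by rewrite divr_ge0// exprn_ge0// ltW.
  have := U_le1 ((1 - p) / e); have := U_le1 ((0 - p) / e).
  by rewrite !ler_norml => /andP[? ?] /andP[? ?]; nra.
have := @le_Rintegral_lincomb R `[0, 1] (fun x => ((1 - icutoff L ((x - p) / e)) * derive1 (@U R) ((x - p) / e)) ^+ 2)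
  [:: (24 / L ^+ 4, fun x => derive1 (@U R) ((x - p) / e))] m01.
rewrite /= addr0 (Rintegral_FTC _ _ _ _ ler01 dF cU); apply.
- by apply: ib; apply: bounded_measurableX; exact: bounded_measurableM.
- by split=> //; exact: ib.
move=> x _; rewrite /lincomb /= addr0.
set y := (x - p) / e; have [c0 c1 c2] := icutoff_itv L y L0.
have [u0 u4] := derive1_U_decay y.
set c := icutoff L y in c0 c1 c2 *; set u := derive1 _ y in u0 u4 *.
have w2 : (1 - c) ^+ 2 <= y ^+ 4 / L ^+ 4.
  rewrite (_ : y ^+ 4 / L ^+ 4 = (y ^+ 2 / L ^+ 2) ^+ 2); last by field; rewrite gt_eqF.
  by apply: lerXn2r => //; rewrite nnegrE; [lra|rewrite divr_ge0// sqr_ge0].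
rewrite exprMn; apply: le_trans (ler_wpM2r (sqr_ge0 _) w2) _.
rewrite (_ : _ * u ^+ 2 = (L ^+ 4)^-1 * u * (y ^+ 4 * u)); last by ring.
rewrite (_ : 24 / L ^+ 4 * u = (L ^+ 4)^-1 * u * 24); last by ring.
by apply: ler_wpM2l => //; rewrite mulr_ge0// invr_ge0 exprn_ge0// ltW.
Qed.

(* Below, [s] is the sign [(-1)^i] of a layer and [psi] the derivative of [beta] in [h_i]. *)
Lemma cutoff_orthogonality {R : realType} (e p L s kap : R) (v psi : R -> R) :
  0 < e -> 0 < L -> 0 <= p + e * (- L) -> p + e * L <= 1 -> s ^+ 2 = 1 ->
  bounded_measurable `[0, 1] v -> measurable_fun (`[0, 1] : set R) psi ->
  (forall x, 0 <= x <= 1 -> `|psi x| <= kap) ->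
  \int[mu]_(x in `[0, 1]) (v x * (- (s / e) * derive1 (@U R) ((x - p) / e) + psi x)) = 0 ->
  (\int[mu]_(x in `[p + e * (- L), p + e * L])
    (cutoff L ((x - p) / e) * v x * derive1 (@U R) ((x - p) / e))) ^+ 2
  <= 2 * (e ^+ 2 * kap ^+ 2 + 48 * e / L ^+ 4) * \int[mu]_(x in `[0, 1]) (v x ^+ 2).
Proof.
move=> e0 L0 p0 p1 s2 bv mpsi psik orth.
have m01 : measurable (`[0, 1]%classic : set (measurableTypeR R)) by exact: measurable_itv.
have bpsi : bounded_measurable `[0, 1] psi.
  by split=> //; exists kap => x; rewrite /= in_itv /=; exact: psik.
have bc := bounded_measurable_icutoff e p L 0 1 e0 L0.
have bU := bounded_measurable_continuous 0 1 _ (@continuous_rescale _ e p _ (@continuous_derive1_U R)).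
have L2b (h : R -> R) : bounded_measurable `[0, 1] h -> L2_on `[0, 1] h.
  by move=> bh; apply: bounded_measurable_L2 => //; exact: itv_lty.
have ib (h : R -> R) : bounded_measurable `[0, 1] h -> mu.-integrable `[0, 1] (EFin \o h).
  by move=> bh; apply: L2_integrable; exact: L2b.
rewrite -(@Rintegral_icutoff _ e p L (fun x c => c * v x * derive1 (@U R) ((x - p) / e)))//; last first.
  by move=> x; rewrite !mul0r.
pose w x := (1 - icutoff L ((x - p) / e)) * derive1 (@U R) ((x - p) / e).
have bw : bounded_measurable `[0, 1] w.
  apply: bounded_measurableM => //; apply: bounded_measurableD; first exact: bounded_measurable_cst.
  exact: bounded_measurableN.
set V := \int[mu]_(x in _) (v x ^+ 2).
have V0 : 0 <= V by apply: Rintegral_ge0 => x _; exact: sqr_ge0.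
pose I1 := \int[mu]_(x in `[0, 1]) (v x * derive1 (@U R) ((x - p) / e)).
pose I2 := \int[mu]_(x in `[0, 1]) (v x * w x).
pose I3 := \int[mu]_(x in `[0, 1]) (v x * psi x).
have ivU := ib _ (bounded_measurableM _ _ _ bv bU).
have ivw := ib _ (bounded_measurableM _ _ _ bv bw).
have ivp := ib _ (bounded_measurableM _ _ _ bv bpsi).
have -> : \int[mu]_(x in `[0, 1]) (icutoff L ((x - p) / e) * v x * derive1 (@U R) ((x - p) / e)) = I1 - I2.
  by rewrite /I1 /I2 -RintegralB//; apply: eq_Rintegral => x _; rewrite /w; ring.
(* Orthogonality to u^h_i trades the full pairing with U' for the pairing with the small function
   [psi]. *)
have I1E : I1 = e * s * I3.
  have : - (s / e) * I1 + I3 = 0.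
    rewrite -orth /I1 /I3 -RintegralZl// -RintegralD//.
      by apply: eq_Rintegral => x _; ring.
    exact: eq_integrable (integrableZl m01 (- (s / e)) ivU).
  move=> /eqP; rewrite addrC mulNr subr_eq0 => /eqP ->.
  rewrite (_ : e * s * (s / e * I1) = s ^+ 2 * I1); first by rewrite s2 mul1r.
  by field; rewrite gt_eqF.
have I3b : I3 ^+ 2 <= V * kap ^+ 2.
  apply: le_trans (cauchy_schwarz_L2 _ _ _ m01 (L2b _ bv) (L2b _ bpsi)) _.
  apply: ler_wpM2l => //.
  rewrite (_ : kap ^+ 2 = \int[mu]_(x in `[0, 1]) (kap ^+ 2)); last first.
    by rewrite Rintegral_cst_itv//; ring.
  apply: le_Rintegral => //.
  - by apply: ib; exact: bounded_measurableX.
  - by apply: ib; exact: bounded_measurable_cst.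
  move=> x; rewrite /= in_itv /= => /psik.
  by rewrite ler_norml => /andP[]; nra.
have I2b : I2 ^+ 2 <= V * (48 * e / L ^+ 4).
  apply: le_trans (cauchy_schwarz_L2 _ _ _ m01 (L2b _ bv) (L2b _ bw)) _.
  by apply: ler_wpM2l => //; exact: cutoff_defect.
have I1b : I1 ^+ 2 <= e ^+ 2 * (V * kap ^+ 2).
  by rewrite I1E !exprMn s2 mulr1; apply: ler_wpM2l => //; exact: sqr_ge0.
have := sqr_ge0 (I1 + I2); nra.
Qed.

(** * Superposition of layers *)

Lemma U_near1 {R : realType} (L y : R) : 0 < L -> L <= y -> `|U y - 1| <= 24 / L ^+ 4.
Proof.
move=> L0 Ly; have y0 : 0 <= y by lra.
have U0 := U_ge0 _ y0; have := U_le1 y; rewrite (ger0_norm U0) => U1.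
rewrite distrC ger0_norm ?subr_ge0//; apply: (@le_trans _ _ (1 - U y ^+ 2)); first nra.
rewrite ler_pdivlMr ?exprn_gt0// mulrC; apply: le_trans (one_sub_U2_decay y).
by apply: (ler_wpM2r (one_sub_U2_ge0 y)); apply: lerXn2r => //; rewrite nnegrE// ltW.
Qed.

Lemma U_nearN1 {R : realType} (L y : R) : 0 < L -> y <= - L -> `|U y + 1| <= 24 / L ^+ 4.
Proof.
move=> L0 yL; have := @U_near1 R L (- y) L0; rewrite lerNr => /(_ yL).
by rewrite UN -opprD normrN.
Qed.

(* Limits of the layers other than the [j]-th at a point close to the [j]-th one:
   their sum for [n = N + 1] is what [beta] compensates. *)
Lemma alternating_sign_sum {R : realType} (j n : nat) :
  \sum_(i < n) (-1) ^+ i * (if (i < j)%N then 1 else if (i == j :> nat)%N then 0 else -1) =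
  (if (n <= j)%N then (1 - (-1) ^+ n) / 2 else (1 + (-1) ^+ n) / 2) :> R.
Proof.
elim: n => [|n IH]; first by rewrite big_ord0 leq0n expr0 subrr mul0r.
rewrite big_ord_recr /= IH; case: (ltngtP n j) => nj.
- by rewrite exprS; field.
- by rewrite exprS; field.
- by rewrite exprS; field.
Qed.

Lemma superposition_near {R : realType} (N : nat) (y : 'I_N.+1 -> R) (j : 'I_N.+1)
    (b L kap : R) : 0 < L ->
  (forall i : 'I_N.+1, (i < j)%N -> L <= y i) ->
  (forall i : 'I_N.+1, (j < i)%N -> y i <= - L) ->
  `|b - ((-1) ^+ N - 1) / 2| <= kap ->
  `|\sum_(i < N.+1) (-1) ^+ i * U (y i) + b - (-1) ^+ j * U (y j)|
    <= N.+1%:R * (24 / L ^+ 4) + kap.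
Proof.
move=> L0 yl yr bk.
(* [tau] holds the limits of the other layers seen from the j-th one, and [del] isolates that layer.
   The signed sum of [tau] is opposite to the constant part of [b], so only the tails and [kap]
   remain. *)
pose tau (i : 'I_N.+1) : R := if (i < j)%N then 1 else if (i == j :> nat)%N then 0 else -1.
pose del (i : 'I_N.+1) : R := if i == j then U (y j) else 0.
have split_sum : \sum_(i < N.+1) (-1) ^+ i * U (y i) =
    \sum_(i < N.+1) (-1) ^+ i * (U (y i) - tau i - del i) + \sum_(i < N.+1) (-1) ^+ i * tau i +
    \sum_(i < N.+1) (-1) ^+ i * del i.
  by rewrite -!big_split /=; apply: eq_bigr => i _; ring.
have dE : \sum_(i < N.+1) (-1) ^+ i * del i = (-1) ^+ j * U (y j).
  rewrite (bigD1 j)//= /del eqxx big1 ?addr0// => i /negbTE ->.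
  by rewrite mulr0.
have tE : \sum_(i < N.+1) (-1) ^+ i * tau i = (1 - (-1) ^+ N) / 2 :> R.
  rewrite alternating_sign_sum leqNgt ltn_ord /= exprS; ring.
rewrite split_sum dE tE.
set T := \sum_(i < N.+1) _.
rewrite (_ : T + _ + _ + b - _ = T + (b - ((-1) ^+ N - 1) / 2)); last by field.
apply: le_trans (ler_normD _ _) _; apply: lerD => //.
apply: le_trans (ler_norm_sum _ _ _) _.
rewrite mulr_natl -[X in _ *+ X]card_ord -sumr_const; apply: ler_sum => i _.
rewrite normrM normrX normrN1 expr1n mul1r /tau /del.
case: (ltngtP i j) => ij.
- by rewrite -val_eqE /= (ltn_eqF ij) subr0; exact/U_near1/yl.
- by rewrite -val_eqE /= (gtn_eqF ij) subr0 opprK; exact/U_nearN1/yr.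
- move: ij => /val_inj ->; rewrite eqxx subr0 subrr normr0.
  by rewrite divr_ge0// exprn_ge0// ltW.
Qed.

(** For u = s U + r the difference of the two values is 6 s U r + 3 r^2. The square has the
    favourable sign, so the one-sided bound needs no smallness of [eta]. *)
Lemma fp_near {R : realType} (u s y eta : R) : s ^+ 2 = 1 ->
  `|u - s * U y| <= eta -> fp (U y) - 6 * eta <= fp u.
Proof.
move=> s2; rewrite ler_norml => /andP[h1 h2]; have := U_le1 y.
rewrite ler_norml => /andP[u1 u2].
set r := u - s * U y in h1 h2; have -> : u = s * U y + r by rewrite /r; ring.
have sp : (s - 1) * (s + 1) = 0 by rewrite -(subrr (1 : R)) -{3}s2; ring.
have : s = 1 \/ s = -1.
  by move/eqP: sp; rewrite mulf_eq0 subr_eq0 addr_eq0 => /orP[/eqP|/eqP]; [left|right].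
rewrite /fp; have := sqr_ge0 r; move=> r2 [->|->]; nra.
Qed.

(** Put S = 1 - U^2, so that f'(U) = 2 - 3S, and c = [icutoff L y]. On the weight 1 - c^2 the 2
    dominates lam / 2, and the loss 3 S (1 - c^2) is at most 6 y^2 S / L^2, where y^2 S <= 25
    follows from 2 y^2 <= 1 + y^4. *)
Lemma potential_lower_bound {R : realType} (lam L y : R) : lam <= 4 -> 0 < L ->
  fp (U y) * icutoff L y ^+ 2 + lam / 2 * (1 - icutoff L y ^+ 2) - 150 / L ^+ 2 <= fp (U y).
Proof.
move=> lam4 L0; have [c0 c1 c2] := icutoff_itv L y L0.
have S0 := one_sub_U2_ge0 y; have S4 := one_sub_U2_decay y.
rewrite fpUE; set S := 1 - U y ^+ 2 in S0 S4 *; set c := icutoff L y in c0 c1 c2 *.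
have S1 : S <= 1 by rewrite /S; have := sqr_ge0 (U y); lra.
have y2S : y ^+ 2 * S <= 25.
  have : 2 * y ^+ 2 <= 1 + y ^+ 4 by have := sqr_ge0 (y ^+ 2 - 1); nra.
  by move=> /(ler_wpM2r S0); have := sqr_ge0 y; nra.
have w0 : 0 <= 1 - c ^+ 2 by nra.
have w2 : 1 - c ^+ 2 <= 2 * (y ^+ 2 / L ^+ 2) by nra.
have Li : 0 <= (L ^+ 2)^-1 by rewrite invr_ge0 sqr_ge0.
have := ler_wpM2r S0 w2; have := ler_wpM2l Li y2S; nra.
Qed.

(** * Geometry of the admissible positions *)

Lemma omega_le {R : realType} (N : nat) (e rho : R) (h : 'I_N.+1 -> R) (i j : 'I_N.+1) :
  in_Omega e rho h -> (i <= j)%N -> h i <= h j.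
Proof.
move=> [_ _ hlt _ _]; rewrite leq_eqVlt => /orP[/eqP/val_inj -> //|ij].
by apply: ltW; exact: hlt.
Qed.

(** The gaps to the mirror positions are twice the distances of the outer layers to the boundary;
    this keeps every cut-off interval inside [0, 1]. *)
Lemma omega_bounds {R : realType} (N : nat) (e rho : R) (h : 'I_N.+1 -> R) (i : 'I_N.+1) :
  in_Omega e rho h -> e / rho / 2 < h i /\ h i < 1 - e / rho / 2.
Proof.
move=> H; have [_ _ _ [h0 hN] _] := H.
have h1 : h ord0 <= h i by apply: omega_le H _.
have h2 : h i <= h ord_max by apply: omega_le H _; rewrite -ltnS.
by split; lra.
Qed.

Lemma omega_gap {R : realType} (N : nat) (e rho : R) (h : 'I_N.+1 -> R) (i j : 'I_N.+1) :
  in_Omega e rho h -> (i < j)%N -> e / rho < h j - h i.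
Proof.
move=> H ij; have [_ _ _ _ gap] := H.
have iN : (i.+1 < N.+1)%N by apply: leq_ltn_trans (ltn_ord j).
have := gap i (Ordinal iN) erefl.
have : h (Ordinal iN) <= h j by apply: omega_le H _.
lra.
Qed.

(** For a minimiser [j] of |x - h_i|, every other layer is farther than half a gap. Hence the
    cut-offs of all other layers vanish at [x], and these layers are close to their limits. *)
Lemma nearest_layer {R : realType} (N : nat) (e rho : R) (h : 'I_N.+1 -> R) (x : R) :
  0 < e -> 0 < rho -> in_Omega e rho h ->
  exists j : 'I_N.+1,
    (forall i : 'I_N.+1, (i < j)%N -> 1 / (2 * rho) < (x - h i) / e) /\
    (forall i : 'I_N.+1, (j < i)%N -> (x - h i) / e < - (1 / (2 * rho))).
Proof.
move=> e0 r0 H.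
have [j _ jmin] := @arg_minP _ R _ (ord0 : 'I_N.+1) xpredT (fun i => `|x - h i|) isT.
have d0 : 0 < e / rho by rewrite divr_gt0.
have E : 1 / (2 * rho) * e = e / rho / 2 by field; rewrite gt_eqF.
exists j; split => i ij.
- have g := omega_gap _ _ _ _ _ _ H ij; have := jmin i isT.
  rewrite ltr_pdivlMr// E.
  by case: (ger0P (x - h j)); case: (ger0P (x - h i)) => *; lra.
- have g := omega_gap _ _ _ _ _ _ H ij; have := jmin i isT.
  rewrite ltr_pdivrMr// mulNr E.
  by case: (ger0P (x - h j)); case: (ger0P (x - h i)) => *; lra.
Qed.

(** [beta_ok] speaks only of admissible positions. Openness in one coordinate keeps the difference
    quotients of [beta] in h_i among them, from which its derivative in h_i is shown to be
    measurable. *)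
Lemma omega_open {R : realType} (N : nat) (e rho : R) (h : 'I_N.+1 -> R) (i : 'I_N.+1) :
  in_Omega e rho h -> exists2 r : R, 0 < r & forall t, `|t| < r -> in_Omega e rho (hupd h i (h i + t)).
Proof.
move=> H; have [h0 hN hlt [g0 gN] gap] := H.
have cont (k : 'I_N.+1) : (fun t : R => hupd h i (h i + t) k) t @[t --> (0 : R)] --> h k.
  rewrite /hupd; case: eqP => [->|_]; last exact: cvg_cst.
  rewrite -[X in _ --> X]addr0; apply: cvgD; first exact: cvg_cst.
  exact: cvg_id.
have open_lt (A B : R -> R) a b : A t @[t --> (0 : R)] --> a -> B t @[t --> (0 : R)] --> b ->
    a < b -> \forall t \near (0 : R), A t < B t.
  move=> cA cB ab; have : B t - A t @[t --> (0 : R)] --> b - a by exact: cvgB.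
  move=> /cvgr_gt /(_ 0); rewrite subr_gt0 => /(_ ab).
  by apply: filterS => t; rewrite subr_gt0.
have : \forall t \near (0 : R), in_Omega e rho (hupd h i (h i + t)).
  have c1 : \forall t \near (0 : R), 0 < hupd h i (h i + t) ord0.
    by apply: open_lt h0; [exact: cvg_cst|exact: cont].
  have c2 : \forall t \near (0 : R), hupd h i (h i + t) ord_max < 1.
    by apply: open_lt hN; [exact: cont|exact: cvg_cst].
  (* The pairs of indices form a finite type, so their neighbourhoods can be intersected. *)
  have c3 : \forall t \near (0 : R), forall p : 'I_N.+1 * 'I_N.+1, (p.1 < p.2)%N ->
      hupd h i (h i + t) p.1 < hupd h i (h i + t) p.2.
    apply: (@filter_forall R _ (fun (p : 'I_N.+1 * 'I_N.+1) (t : R) => (p.1 < p.2)%N ->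
      hupd h i (h i + t) p.1 < hupd h i (h i + t) p.2) (nbhs (0 : R)) _) => -[k l] /=.
    have [kl|kl] := boolP (k < l)%N; last by near=> t.
    have := open_lt _ _ _ _ (cont k) (cont l) (hlt _ _ kl).
    by apply: filterS => t.
  have c4 : \forall t \near (0 : R), e / rho < hupd h i (h i + t) ord0 - (- hupd h i (h i + t) ord0).
    apply: open_lt g0; first exact: cvg_cst.
    by apply: cvgB; [exact: cont|apply: cvgN; exact: cont].
  have c5 : \forall t \near (0 : R), e / rho < (2 - hupd h i (h i + t) ord_max) - hupd h i (h i + t) ord_max.
    apply: open_lt gN; first exact: cvg_cst.
    by apply: cvgB; [apply: cvgB; [exact: cvg_cst|exact: cont]|exact: cont].
  have c6 : \forall t \near (0 : R), forall p : 'I_N.+1 * 'I_N.+1, p.2 = p.1.+1 :> nat ->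
      e / rho < hupd h i (h i + t) p.2 - hupd h i (h i + t) p.1.
    apply: (@filter_forall R _ (fun (p : 'I_N.+1 * 'I_N.+1) (t : R) => p.2 = p.1.+1 :> nat ->
      e / rho < hupd h i (h i + t) p.2 - hupd h i (h i + t) p.1) (nbhs (0 : R)) _) => -[k l] /=.
    have [kl|kl] := eqVneq (l : nat) k.+1; last by near=> t => lk; case/eqP: kl.
    have : \forall t \near (0 : R), e / rho < hupd h i (h i + t) l - hupd h i (h i + t) k.
      apply: open_lt (gap _ _ kl); first exact: cvg_cst.
      by apply: cvgB; exact: cont.
    by apply: filterS => t.
  near=> t; split.
  - by near: t.
  - by near: t.
  - by move=> k l kl; apply: (near c3 t _ (k, l)).
  - by split; near: t.
  - by move=> k l kl; apply: (near c6 t _ (k, l)).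
move=> /nbhs_ballP[r /= r0 rP]; exists r => // t tr; apply: rP.
by rewrite /ball /= sub0r normrN.
Unshelve. all: by end_near. Qed.

(** * The derivatives in the positions of the layers *)

Lemma derive1_cvg_seq {R : realType} (F : R -> R) (a : R) (t : nat -> R) :
  derivable F a 1 -> (forall n, t n != 0) -> t n @[n --> \oo] --> (0 : R) ->
  ((t n)^-1 * (F (a + t n) - F a)) @[n --> \oo] --> derive1 F a.
Proof.
move=> dF tn0 t0.
have dF1 : (fun s : R => s^-1 *: (F (s *: (1 : R) + a) - F a)) @ 0^' --> derive1 F a.
  by rewrite derive1E; exact: dF.
move=> A /dF1 FA.
have {}FA : \forall s \near (0 : R), s != 0 -> A (s^-1 *: (F (s *: (1 : R) + a) - F a)) by exact: FA.
have {}FA : \forall n \near \oo, t n != 0 -> A ((t n)^-1 *: (F (t n *: (1 : R) + a) - F a)).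
  exact: (t0 _ FA).
change (\forall n \near \oo, A ((t n)^-1 * (F (a + t n) - F a))).
near=> n; have : t n != 0 -> A ((t n)^-1 *: (F (t n *: (1 : R) + a) - F a)) by near: n.
by rewrite /GRing.scale /= mulr1 (addrC a); apply; exact: tn0.
Unshelve. all: by end_near. Qed.

(* Needed because the library's integral of a non-measurable function is not additive. *)
Lemma measurable_derive1_param {R : realType} (D : set R) (a r : R) (b : R -> R -> R) :
  measurable D -> 0 < r ->
  (forall t, `|t| < r -> measurable_fun D (b (a + t))) ->
  (forall x, D x -> derivable (b ^~ x) a 1) ->
  measurable_fun D (fun x => derive1 (b ^~ x) a).
Proof.
move=> mD r0 mb db.
(* With [n.+2] already the first increment is strictly smaller than [r]. *)
pose t n : R := r / n.+2%:R.
have tpos n : 0 < t n by rewrite divr_gt0.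
have tr n : `|t n| < r.
  by rewrite gtr0_norm// /t ltr_pdivrMr// ltr_pMr// ltr1n.
have t0 : t n @[n --> \oo] --> (0 : R).
  rewrite -[X in _ --> X](mulr0 r); apply: cvgM; first exact: cvg_cst.
  have := @cvg_harmonic R; rewrite -(cvg_shiftS (@harmonic R)).
  by apply: cvg_trans; apply: near_eq_cvg; near=> n.
apply: (@measurable_fun_cvg _ _ _ D (fun n x => (t n)^-1 * (b (a + t n) x - b a x))).
  move=> n; apply: measurable_funM; first exact: measurable_cst.
  apply: measurable_funB; first exact: mb.
  by have := mb 0; rewrite normr0 addr0; exact.
move=> x Dx; apply: (@derive1_cvg_seq R (b ^~ x) a t) => //; first exact: db.
by move=> n; rewrite gt_eqF.
Unshelve. all: by end_near. Qed.

Lemma bounded_measurable_derivable {R : realType} (a b : R) (h : R -> R) :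
  (forall x, a <= x <= b -> derivable h x 1) -> bounded_measurable `[a, b] h.
Proof.
move=> dh; apply: bounded_measurable_within; apply: continuous_in_subspaceT => x.
rewrite inE /= in_itv /= => /dh d; apply: differentiable_continuous.
exact/derivable1_diffP.
Qed.

Lemma uhiE {R : realType} (N : nat) (e x : R) (beta : ('I_N.+1 -> R) -> R -> R)
    (h : 'I_N.+1 -> R) (i : 'I_N.+1) : 0 < e ->
  derivable (fun t => beta (hupd h i t) x) (h i) 1 ->
  uhi e beta h i x = - ((-1) ^+ i / e) * derive1 (@U R) ((x - h i) / e) +
    derive1 (fun t => beta (hupd h i t) x) (h i).
Proof.
move=> e0 db.
pose c := \sum_(k < N.+1 | k != i) (-1) ^+ k * U ((x - h k) / e).
rewrite /uhi (_ : (fun t => _) = fun t => (c + (-1) ^+ i * U ((x - t) / e)) + beta (hupd h i t) x); last first.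
  apply/funext => t; rewrite /uh (bigD1 i)//= {1}/hupd eqxx; congr (_ + _).
  rewrite addrC; congr (_ + _); apply: eq_bigr => k /negbTE ki.
  by rewrite /hupd ki.
have d1 : is_derive (h i) (1 : R) (fun t : R => (x - t) / e) (- e^-1).
  by apply: is_derive_eq; rewrite /GRing.scale /=; ring.
have d2 := @is_derive1_comp R (@U R) (fun t : R => (x - t) / e) (h i) _ _ (is_derive_U _) d1.
have d3 := @is_deriveZ R R R _ ((-1) ^+ i) (h i) 1 _ d2.
have d4 := @is_deriveD R R R (fun=> c) _ (h i) 1 _ _ (is_derive_cst _ _ _) d3.
have d5 := @is_deriveD R R R _ _ (h i) 1 _ _ d4 (derivableP db).
rewrite derive1E; etransitivity; first exact: (@derive_val _ _ _ _ _ _ _ d5).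
by rewrite derive1_U -derive1E /GRing.scale /=; field; rewrite !gt_eqF// sqrtr_gt0.
Qed.

(** From e^t >= t^2 / 2 at t = c / rho: exponential smallness is traded for the order rho^2 of the
    final error. *)
Lemma expRN_le {R : realType} (c rho : R) : 0 < c -> 0 < rho ->
  expR (- c / rho) <= 2 / c ^+ 2 * rho ^+ 2.
Proof.
move=> c0 r0; have t0 : 0 < c / rho by rewrite divr_gt0.
rewrite mulNr expRN -[leRHS]invrK lef_pV2 ?posrE ?expR_gt0 ?invr_gt0//; last first.
  by rewrite mulr_gt0 ?exprn_gt0// divr_gt0// exprn_gt0.
have := @expR_ge1Dxn R _ 1 (ltW t0); rewrite (_ : 2`! = 2)%N//.
move=> H; apply: le_trans H.
rewrite (_ : _^-1 = (c / rho) ^+ 2 / 2); last by field; rewrite !gt_eqF.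
by rewrite lerDr.
Qed.

Lemma powR_small {R : realType} (kappa eps : R) : 0 < kappa -> 0 < eps ->
  eps < (1 / 2) `^ kappa^-1 -> eps `^ kappa <= 1 / 2.
Proof.
move=> k0 e0 ee.
have -> : 1 / 2 = ((1 / 2) `^ kappa^-1) `^ kappa :> R.
  by rewrite -powRrM mulVf ?gt_eqF// powRr1.
by apply: ge0_ler_powR; rewrite ?nnegrE ?powR_ge0 ?ltW.
Qed.

(** * Estimate for one layer and assembly *)

Lemma layer_estimate {R : realType} (lam : R) : 0 < lam -> lambda0_prop lam ->
  exists2 C : R, 0 < C & forall (e p L s kap : R) (v g psi : R -> R),
  0 < e -> 1 <= L -> 0 <= p + e * (- L) -> p + e * L <= 1 -> s ^+ 2 = 1 ->
  H1_01 v g -> measurable_fun (`[0, 1] : set R) psi ->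
  (forall x, 0 <= x <= 1 -> `|psi x| <= kap) ->
  \int[mu]_(x in `[0, 1]) (v x * (- (s / e) * derive1 (@U R) ((x - p) / e) + psi x)) = 0 ->
  lam / 2 * \int[mu]_(x in `[0, 1]) ((icutoff L ((x - p) / e) * v x) ^+ 2)
    - C * (1 / L ^+ 2 + L * e * kap ^+ 2) * \int[mu]_(x in `[0, 1]) (v x ^+ 2)
  <= e ^+ 2 * \int[mu]_(x in `[0, 1]) ((icutoff L ((x - p) / e) * g x) ^+ 2)
     + \int[mu]_(x in `[0, 1]) (fp (U ((x - p) / e)) * (icutoff L ((x - p) / e) * v x) ^+ 2).
Proof.
move=> lam0 lamP; have [C C0 H] := localized_coercivity_scaled _ lam0 lamP.
(* 97 = 1 + 2 * 48: one 1 / L^2 from the mass term, and 96 / L^3 <= 96 / L^2 from the cut-off defect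
   in the pairing. *)
exists (97 * C); first by rewrite mulr_gt0.
move=> e p L s kap v g psi e0 L1 p0 p1 s2 [Lg vE] mpsi psik orth.
have L0 : 0 < L by apply: lt_le_trans L1.
have bv : bounded_measurable `[0, 1] v.
  apply: bounded_measurable_primitive Lg _ => //; exact: ler01.
set D := `[p + e * (- L), p + e * L]%classic.
have D01 : D `<=` `[0, 1] by apply: subset_itv; rewrite bnd_simp.
have m01 : measurable (`[0, 1]%classic : set (measurableTypeR R)) by exact: measurable_itv.
have mD : measurable (D : set (measurableTypeR R)) by exact: measurable_itv.
have LgD : L2_on D g by exact: L2_onS Lg.
have pL : p + e * (- L) <= p + e * L by rewrite lerD2l ler_pM2l//; lra.
have vED x : p + e * (- L) <= x <= p + e * L ->
    v x = v (p + e * (- L)) + \int[mu]_(t in `[p + e * (- L), x]) g t.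
  move=> /andP[x1 x2].
  rewrite -(@Rintegral_itv_diff _ 0 1)//; last 2 first.
  - exact: L2_integrable.
  - exact: le_trans p1.
  rewrite vE ?(le_trans p0 x1) ?(le_trans x2 p1)// (vE (p + e * (- L))) ?p0 ?(le_trans pL p1)//.
  by ring.
have B2 := cutoff_orthogonality _ _ _ _ _ _ _ e0 L0 p0 p1 s2 bv mpsi psik orth.
have := H e p L v g e0 L1 LgD vED.
rewrite (@Rintegral_icutoff _ e p L (fun x c => (c * v x) ^+ 2))//; last first.
  by move=> x; rewrite mul0r expr0n.
rewrite (@Rintegral_icutoff _ e p L (fun x c => (c * g x) ^+ 2))//; last first.
  by move=> x; rewrite mul0r expr0n.
rewrite (@Rintegral_icutoff _ e p L (fun x c => fp (U ((x - p) / e)) * (c * v x) ^+ 2))//; last first.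
  by move=> x; rewrite mul0r expr0n mulr0.
apply: le_trans; apply: lerB => //.
have VD : \int[mu]_(x in D) (v x ^+ 2) <= \int[mu]_(x in `[0, 1]) (v x ^+ 2).
  apply: ge0_le_Rintegral_subset => //; last by move=> x _; exact: sqr_ge0.
  apply: L2_integrable_sqr => //; apply: bounded_measurable_L2 => //; exact: itv_lty.
move: B2 VD; set V := \int[mu]_(x in `[0, 1]) (v x ^+ 2); set VD := \int[mu]_(x in D) (v x ^+ 2).
set B := \int[mu]_(x in _) _ => B2 VDV.
have V0 : 0 <= V by apply: Rintegral_ge0 => x _; exact: sqr_ge0.
have t1 : VD / L ^+ 2 <= 1 / L ^+ 2 * V by rewrite mul1r mulrC ler_wpM2l// invr_ge0 sqr_ge0.
have t2 : L / e * B ^+ 2 <= 2 * (L * e * kap ^+ 2 + 48 / L ^+ 3) * V.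
  rewrite (_ : _ * V = L / e * (2 * (e ^+ 2 * kap ^+ 2 + 48 * e / L ^+ 4) * V)); last first.
    by field; rewrite !gt_eqF.
  by apply: ler_wpM2l => //; rewrite divr_ge0 ?ltW.
have t3 : 48 / L ^+ 3 <= 48 * (1 / L ^+ 2).
  rewrite mul1r ler_pM2l// lef_pV2 ?posrE ?exprn_gt0//.
  by rewrite (exprS L 2) ler_peMl// sqr_ge0.
rewrite (_ : 97 * C * _ * V = C * (97 * ((1 / L ^+ 2 + L * e * kap ^+ 2) * V))); last by ring.
apply: ler_wpM2l; first exact: ltW.
have t4 : 0 <= L * e * kap ^+ 2 := mulr_ge0 (mulr_ge0 (ltW L0) (ltW e0)) (sqr_ge0 kap).
have t5 := mulr_ge0 t4 V0.
have t6 := ler_wpM2r V0 t3.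
lra.
Qed.

Theorem theorem4p2 (R : realType) (N : nat) :
  exists kbar : R, 0 < kbar /\
  forall kappa0 : R, 0 < kappa0 < kbar ->
  forall lambda0 : R, 0 < lambda0 -> lambda0_prop lambda0 ->
  forall K c : R, 0 < K -> 0 < c ->
  exists eps0 C : R, 0 < eps0 /\
  forall eps : R, 0 < eps < eps0 ->
  let rho := eps `^ kappa0 in
  forall beta : ('I_N.+1 -> R) -> R -> R, beta_ok eps rho K c beta ->
  forall h : 'I_N.+1 -> R, in_Omega eps rho h ->
  forall v g : R -> R, H1_01 v g ->
  (forall i : 'I_N.+1,
     Rintegral (leb R) `[0, 1] (fun x => v x * uhi eps beta h i x) = 0) ->
  - eps ^+ 2 * Rintegral (leb R) `[0, 1] (fun x => (g x) ^+ 2)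
    - Rintegral (leb R) `[0, 1] (fun x => fp (uh eps beta h x) * (v x) ^+ 2)
  <= (- (lambda0 / 2) + C * rho ^+ 2) * Rintegral (leb R) `[0, 1] (fun x => (v x) ^+ 2).
Proof.
exists 1; split=> // kappa0 /andP[k0 _] lam lam0 lamP K c K0 c0.
have lam4 := lambda0_le4 _ lamP.
have [C1 C10 layer] := layer_estimate _ lam0 lamP.
pose kap1 : R := K * (2 / c ^+ 2).
have kap10 : 0 < kap1 by rewrite mulr_gt0// divr_gt0// exprn_gt0.
(* The second entry gives rho <= 1/2, hence L = 1 / (2 rho) >= 1. *)
exists (Num.min 1 ((1 / 2) `^ kappa0^-1)).
(* The first summand collects the losses of the N + 1 layers, with 1 / L^2 = 4 rho^2. The second is
   6 times the superposition error, where 384 rho^4 <= 96 rho^2, plus 150 / L^2 = 600 rho^2 from the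
   potential. *)
exists (N.+1%:R * (C1 * (4 + kap1 ^+ 2)) + (6 * (96 * N.+1%:R + kap1) + 600)).
split; first by rewrite lt_min ltr01 powR_gt0.
move=> e /andP[e0]; rewrite lt_min => /andP[e1 esmall] rho beta bok h Hh v g Hv orth.
have r0 : 0 < rho by rewrite powR_gt0.
have r12 : rho <= 1 / 2 by exact: powR_small.
pose L : R := 1 / (2 * rho).
have L0 : 0 < L by rewrite divr_gt0// mulr_gt0.
have L1 : 1 <= L by rewrite ler_pdivlMr ?mulr_gt0//; lra.
have L2E : 1 / L ^+ 2 = 4 * rho ^+ 2 by rewrite /L; field; rewrite gt_eqF.
have L4E : 24 / L ^+ 4 = 384 * rho ^+ 4 by rewrite /L; field; rewrite gt_eqF.
have r2 := sqr_ge0 rho.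
pose kap := K * expR (- c / rho).
have kap0 : 0 <= kap by rewrite mulr_ge0 ?expR_ge0// ltW.
have kapb : kap <= kap1 * rho ^+ 2.
  by rewrite /kap /kap1 -mulrA ler_pM2l//; exact: expRN_le.
have [Lg vE] := Hv.
have bv : bounded_measurable `[0, 1] v by apply: bounded_measurable_primitive Lg _ => //; exact: ler01.
have m01 : measurable (`[0, 1]%classic : set (measurableTypeR R)) by exact: measurable_itv.
have Lv : L2_on `[0, 1] v by apply: bounded_measurable_L2 => //; exact: itv_lty.
have [_ _ b0 b1 b2] := bok h Hh.
have mbeta h' : in_Omega e rho h' -> bounded_measurable `[0, 1] (beta h').
  move=> /bok[_ _ _ d _]; apply: bounded_measurable_derivable => x x01.
  by case: (d x x01).
pose psi i x := derive1 (fun t => beta (hupd h i t) x) (h i).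
have mpsi i : measurable_fun (`[0, 1] : set R) (psi i).
  have [r rpos rP] := omega_open _ _ _ _ i Hh.
  apply: (@measurable_derive1_param R `[0, 1] (h i) r (fun t x => beta (hupd h i t) x)) => //.
    by move=> t tr; have [] := mbeta _ (rP t tr).
  by move=> x; rewrite /= in_itv /= => x01; case: (b2 i x x01).
have psib i x : 0 <= x <= 1 -> `|psi i x| <= kap by move=> x01; case: (b2 i x x01).
have eL : e * L = e / rho / 2 by rewrite /L; field; rewrite gt_eqF.
have hb i : 0 <= h i + e * (- L) /\ h i + e * L <= 1.
  by have [] := omega_bounds _ _ _ _ i Hh; rewrite mulrN eL; split; lra.
set V := \int[mu]_(x in `[0, 1]) (v x ^+ 2).
have V0 : 0 <= V by apply: Rintegral_ge0 => x _; exact: sqr_ge0.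
pose ic i x := icutoff L ((x - h i) / e).
(* The form localised at layer [i], with opposite sign and shifted by lambda0 / 2: its integral is
   bounded below by a multiple of - rho^2 V, and the sum over [i] is compared pointwise with the
   full form. *)
pose Q i := [:: (e ^+ 2, fun x => (ic i x * g x) ^+ 2);
  (1, fun x => fp (U ((x - h i) / e)) * (ic i x * v x) ^+ 2);
  (- (lam / 2), fun x => (ic i x * v x) ^+ 2)].
have bic i : bounded_measurable `[0, 1] (ic i) by exact: bounded_measurable_icutoff.
have bU i : bounded_measurable `[0, 1] (fun x => fp (U ((x - h i) / e))).
  apply: bounded_measurable_continuous.
  exact: (@continuous_rescale _ e (h i) _ (@continuous_fpU R)).
have iv2 i : mu.-integrable `[0, 1] (EFin \o (fun x => (ic i x * v x) ^+ 2)).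
  by apply: L2_integrable_sqr => //; exact: L2_onM.
have iQ i : all_integrable `[0, 1] (Q i).
  split; first by apply: L2_integrable_sqr => //; exact: L2_onM.
  split; first by apply: integrable_bounded_measurableM.
  by split; [exact: iv2|].
have Qlow i : - (C1 * (4 + kap1 ^+ 2)) * rho ^+ 2 * V <= \int[mu]_(x in `[0, 1]) lincomb (Q i) x.
  rewrite Rintegral_lincomb// /Q /= addr0 mul1r.
  have [p0 p1] := hb i.
  have orth_i : \int[mu]_(x in `[0, 1]) (v x * (- ((-1) ^+ i / e) * derive1 (@U R) ((x - h i) / e) + psi i x)) = 0.
    rewrite -[RHS](orth i); apply: eq_Rintegral => x; rewrite inE /= in_itv /= => x01.
    by rewrite uhiE//; case: (b2 i x x01).
  have s2 : ((-1) ^+ i : R) ^+ 2 = 1 by rewrite sqrr_sign.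
  have := layer e (h i) L ((-1) ^+ i) kap v g (psi i) e0 L1 p0 p1 s2 Hv (mpsi i) (psib i) orth_i.
  rewrite -/V -/(ic i) L2E => est.
  have Lk : L * e * kap ^+ 2 <= kap1 ^+ 2 * rho ^+ 2.
    have kk : kap ^+ 2 <= (kap1 * rho ^+ 2) ^+ 2.
      by apply: lerXn2r => //; rewrite nnegrE// mulr_ge0// ltW.
    have Le : 0 <= L * e by rewrite mulr_ge0// ltW.
    apply: le_trans (ler_wpM2l Le kk) _.
    (* The growing factor L is harmless, since kap^2 is of order rho^4: L e rho^4 = rho^2 (e rho /
       2). *)
    rewrite (_ : L * e * _ = kap1 ^+ 2 * rho ^+ 2 * (e * rho / 2)); last by rewrite /L; field; rewrite gt_eqF.
    apply: ler_piMr; first by rewrite mulr_ge0 ?sqr_ge0.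
    nra.
  have := ler_wpM2r V0 (ler_wpM2l (ltW C10) (lerD (lexx (4 * rho ^+ 2)) Lk)).
  rewrite /ic in est *; lra.
have bu : bounded_measurable `[0, 1] (fun x => fp (uh e beta h x)).
  apply: bounded_measurableD; last exact: bounded_measurable_cst.
  apply: bounded_measurableM; first exact: bounded_measurable_cst.
  apply: bounded_measurableX; apply: bounded_measurableD; last exact: mbeta.
  have : forall s : seq 'I_N.+1, bounded_measurable `[0, 1] (fun x => \sum_(i <- s) (-1) ^+ i * U ((x - h i) / e)).
    elim=> [|i s IH].
      by rewrite (_ : (fun x => _) = fun=> 0); [exact: bounded_measurable_cst|apply/funext => x; rewrite big_nil].
    rewrite (_ : (fun x => _) = fun x => (-1) ^+ i * U ((x - h i) / e) + \sum_(k <- s) (-1) ^+ k * U ((x - h k) / e)); last first.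
      by apply/funext => x; rewrite big_cons.
    apply: bounded_measurableD => //; apply: bounded_measurableM; first exact: bounded_measurable_cst.
    by apply: bounded_measurable_continuous; exact: (@continuous_rescale _ e (h i) _ (@continuous_U R)).
  exact.
pose Cp := 6 * (96 * N.+1%:R + kap1) + 600.
have pointwise x : `[0, 1]%classic x -> \sum_(i < N.+1) lincomb (Q i) x <=
   lincomb [:: (e ^+ 2, fun x => g x ^+ 2); (1, fun x => fp (uh e beta h x) * v x ^+ 2);
     (- (lam / 2 - Cp * rho ^+ 2), fun x => v x ^+ 2)] x.
  rewrite /= in_itv /= => x01.
  have [j [jl jr]] := nearest_layer _ _ _ _ x e0 r0 Hh.
  (* Only the nearest layer contributes at [x], so the comparison is between one localised integrand
     and the full one. *)
  rewrite (bigD1 j)//= big1 ?addr0; last first.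
    move=> i ij; have ic0 : ic i x = 0.
      rewrite /ic /icutoff ifF//; apply/negbTE; rewrite negb_and -!ltNge.
      move: ij; rewrite -val_eqE neq_ltn => /orP[/jl|/jr]; rewrite -/L => ->; by rewrite ?orbT.
    by rewrite /lincomb /Q /= ic0 !mul0r expr0n /= !mulr0 !addr0.
  have near := superposition_near N (fun i => (x - h i) / e) j (beta h x) L kap L0
    (fun i ij => ltW (jl i ij)) (fun i ij => ltW (jr i ij)) (b0 x x01).
  have s2 : ((-1) ^+ j : R) ^+ 2 = 1 by rewrite sqrr_sign.
  have fpn := fp_near _ _ _ _ s2 near.
  have pot := potential_lower_bound lam L ((x - h j) / e) lam4 L0.
  have [c1 c2 _] := icutoff_itv L ((x - h j) / e) L0.
  rewrite -[\sum_(i < N.+1) _ + beta h x]/(uh e beta h x) in fpn.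
  move: fpn pot c1 c2; rewrite /lincomb /Q /= -/(ic j x).
  have -> : 150 / L ^+ 2 = 600 * rho ^+ 2 by rewrite -[150]mulr1 -mulrA L2E; ring.
  rewrite L4E; set P := fp (U _); set u := fp (uh _ _ _ _); set q := ic j x.
  move=> fpn pot c1 c2.
  have rr : rho * rho <= 1 / 4 by nra.
  have r4 : rho ^+ 4 <= rho ^+ 2 / 4.
    by rewrite (_ : rho ^+ 4 = rho ^+ 2 * (rho * rho)); [have := ler_wpM2l r2 rr; lra|ring].
  have NN : N.+1%:R * (384 * rho ^+ 4) <= N.+1%:R * (96 * rho ^+ 2) by rewrite ler_wpM2l//; lra.
  have up : P * q ^+ 2 + lam / 2 * (1 - q ^+ 2) - Cp * rho ^+ 2 <= u by rewrite /Cp; lra.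
  have q2 : q ^+ 2 <= 1 by rewrite expr_le1.
  have g2 : q ^+ 2 * (e ^+ 2 * g x ^+ 2) <= e ^+ 2 * g x ^+ 2.
    by rewrite ler_piMl// mulr_ge0 ?sqr_ge0.
  have := ler_wpM2r (sqr_ge0 (v x)) up.
  rewrite !exprMn; lra.
have [iS SE] := Rintegral_sum _ (index_enum _) _ (fun i => lincomb (Q i)) m01 (fun i => integrable_lincomb _ _ m01 (iQ i)).
have iu : mu.-integrable `[0, 1] (EFin \o (fun x => fp (uh e beta h x) * v x ^+ 2)).
  by apply: integrable_bounded_measurableM => //; exact: L2_integrable_sqr.
have ints : all_integrable `[0, 1] [:: (e ^+ 2, fun x => g x ^+ 2); (1, fun x => fp (uh e beta h x) * v x ^+ 2);
     (- (lam / 2 - Cp * rho ^+ 2), fun x => v x ^+ 2)].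
  by split; [exact: L2_integrable_sqr|split=> //; split=> //; exact: L2_integrable_sqr].
have := le_Rintegral_lincomb _ _ _ m01 iS ints pointwise.
rewrite SE /= -/V addr0 mul1r => main.
have low : N.+1%:R * (- (C1 * (4 + kap1 ^+ 2)) * rho ^+ 2 * V) <= \sum_(i < N.+1) \int[mu]_(x in `[0, 1]) lincomb (Q i) x.
  rewrite mulr_natl -[X in _ *+ X]card_ord -sumr_const; apply: ler_sum => i _; exact: Qlow.
have := le_trans low main; rewrite /Cp.
set I1 := \int[mu]_(x in _) _; set I2 := \int[mu]_(x in _) _.
by move=> fin; lra.
Qed.
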